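(* Let $F_1,F_2\in\mathbb{K}[X_1,X_2,X_3]$ be homogeneous of degree $2$ without common factors, such that $F_1(0,0,1)=F_2(0,0,1)=0$. Write $$T_1F_2(X)-T_2F_1(X)=l_1(T)X_1X_2+l_2(T)X_1X_3+l_3(T)X_2X_3+l_4(T)X_1^2+l_5(T)X_2^2,$$ with each $l_i(T)\in\mathbb{K}[T_1,T_2]$ a homogeneous linear form. Suppose that the conic defined by $T_1F_2(X)-T_2F_1(X)$ in $\mathbb{P}^2_{\overline{\mathbb{K}(T_1,T_2)}}$ is nondegenerate. Then for any pair $a(T),b(T)\in\mathbb{K}[T_1,T_2]$ of homogeneous polynomials of the same degree $d_0>1$ without common factors, the polynomials $$\begin{array}{rcl} u_1(T)&=&-a(T)\big(a(T)l_2(T)+b(T)l_3(T)\big),\\ u_2(T)&=&-b(T)\big(a(T)l_2(T)+b(T)l_3(T)\big),\\ u_3(T)&=&a(T)b(T)l_1(T)+a(T)^2l_4(T)+b(T)^2l_5(T) \end{array}$$ define a proper parameterization of a curve $C\subset\mathbb{P}^2$ that is parameterizable by $(F_1,F_2)$. Moreover, if $$\gcd\big(X_1\,l_2(F_1,F_2)+X_2\,l_3(F_1,F_2),\; a(F_1,F_2)X_2-b(F_1,F_2)X_1\big)=1,$$ then $\gcd(u_1,u_2,u_3)=1$, $\deg(C)=2d_0+1$, and $a(F_1,F_2)X_2-b(F_1,F_2)X_1$ is an irreducible polynomial defining $C$.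
   Context: $\mathbb{K}$ is an algebraically closed field, $T=(T_1,T_2)$, $X=(X_1,X_2,X_3)$, and $\overline{\mathbb{K}(T_1,T_2)}$ is the algebraic closure of $\mathbb{K}(T_1,T_2)$. A conic is degenerate if its defining quadratic form is a product of two linear forms over the (algebraically closed) base field; otherwise it is nondegenerate. A plane curve of degree $d$ is the zero locus in $\mathbb{P}^2$ of an irreducible homogeneous polynomial of degree $d$. For homogeneous $F_1,F_2\in\mathbb{K}[X]$ of the same degree and without common factors, a curve $C\subset\mathbb{P}^2$ is parameterizable by $(F_1,F_2)$ if the rational map $\psi:C\dashrightarrow\mathbb{P}^1$, $x\mapsto(F_1(x):F_2(x))$, is birational with inverse a map $\phi:\mathbb{P}^1\to C$ given by three homogeneous polynomials in $\mathbb{K}[T_1,T_2]$ of the same degree without common factors. A parameterization is proper if it is generically injective (birational onto $C$). The three polynomials $u_1,u_2,u_3$ of the statement may have a nontrivial common factor; the map $\mathbb{P}^1\to\mathbb{P}^2$ they define is the one obtained after dividing them by their gcd, and it is the inverse of $\psi$. *)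

(* Defs.v *)
From HB Require Import structures.
From mathcomp Require Import all_boot all_order all_algebra.
From mathcomp Require Export fraction mxpoly.
From mathcomp.multinomials Require Export mpoly.

Set Implicit Arguments.
Unset Strict Implicit.
Unset Printing Implicit Defensive.

Import GRing.Theory.
Local Open Scope ring_scope.

Section Divisibility.
Variables (n : nat) (K : fieldType).
Implicit Types (p q d : {mpoly K[n]}) (s : seq {mpoly K[n]}).

Definition mdvd d p : Prop := exists q, p = q * d.

(* The gcd is only defined up to a unit, hence a relation; [is_gcd s 1] says
   that the members of s have no nonconstant common factor. *)
Definition is_gcd s d : Prop :=
  {in s, forall p, mdvd d p} /\
  (forall e, {in s, forall p, mdvd e p} -> mdvd e d).

Definition mirreducible p : Prop :=
  [/\ p != 0, p \isn't a GRing.unit &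
      forall q r, p = q * r -> q \is a GRing.unit \/ r \is a GRing.unit].

End Divisibility.

(* Points of P^(n-1) are represented by nonzero row vectors up to [proj_eq],
   and subsets of P^(n-1) by sets of nonzero row vectors. *)
Section Projective.
Variable K : fieldType.

Definition proj_eq n (x y : 'rV[K]_n) : Prop := exists2 c, c != 0 & x = c *: y.

Definition proj_space n : pred 'rV[K]_n := [pred x : 'rV[K]_n | x != 0].

Definition zero_locus n (p : {mpoly K[n]}) : pred 'rV[K]_n :=
  [pred x : 'rV[K]_n | (x != 0) && (p.@[x 0] == 0)].

(* Q holds on a nonempty Zariski open subset of V. Basic open sets h <> 0
   suffice; for irreducible V these are exactly the dense properties. *)
Definition generically n (V : pred 'rV[K]_n) (Q : 'rV[K]_n -> Prop) : Prop :=
  exists k (h : {mpoly K[n]}),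
    [/\ h \is k.-homog,
        exists2 x, x \in V & h.@[x 0] != 0 &
        forall x, x \in V -> h.@[x 0] != 0 -> Q x].

Definition same_degree m n (f : m.-tuple {mpoly K[n]}) : Prop :=
  exists d, forall i, tnth f i \is d.-homog.

Definition eval_forms m n (f : m.-tuple {mpoly K[n]}) (x : 'rV[K]_n) :
  'rV[K]_m := \row_i (tnth f i).@[x 0].

(* The forms f define a rational map from V to W; the values of f must in
   particular be generically nonzero, as W consists of nonzero vectors. *)
Definition rational_map m n (V : pred 'rV[K]_n) (W : pred 'rV[K]_m)
    (f : m.-tuple {mpoly K[n]}) : Prop :=
  same_degree f /\ generically V (fun x => eval_forms f x \in W).

Definition birational_inverses m n (V : pred 'rV[K]_n) (W : pred 'rV[K]_m)
    (f : m.-tuple {mpoly K[n]}) (g : n.-tuple {mpoly K[m]}) : Prop :=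
  [/\ rational_map V W f, rational_map W V g,
      generically V (fun x => proj_eq (eval_forms g (eval_forms f x)) x) &
      generically W (fun y => proj_eq (eval_forms f (eval_forms g y)) y)].

End Projective.

Record plane_curve (K : closedFieldType) := PlaneCurve {
  curve_poly : {mpoly K[3]};
  curve_degree : nat;
  curve_homog : curve_poly \is curve_degree.-homog;
  curve_irred : mirreducible curve_poly }.

Definition curve_points (K : closedFieldType) (C : plane_curve K) :
  pred 'rV[K]_3 := zero_locus (curve_poly C).

Section Parameterizations.
Variable K : closedFieldType.
Implicit Types (C : plane_curve K) (phi u : 3.-tuple {mpoly K[2]}).

Definition param_map C phi : Prop :=
  [/\ same_degree phi, is_gcd phi 1 &
      forall t, t \in @proj_space K 2 -> eval_forms phi t \in curve_points C].

(* Properness is birationality onto C; in positive characteristic this is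
   stronger than generic injectivity on points (consider Frobenius). *)
Definition proper_param C phi : Prop :=
  param_map C phi /\
  exists psi, birational_inverses (@proj_space K 2) (curve_points C) phi psi.

Definition param_inverse C (F : 2.-tuple {mpoly K[3]}) phi : Prop :=
  param_map C phi /\
  birational_inverses (curve_points C) (@proj_space K 2) F phi.

Definition parameterizable_by C (F : 2.-tuple {mpoly K[3]}) : Prop :=
  exists phi, param_inverse C F phi.

(* phi is obtained from u by dividing out the (nonzero) gcd. *)
Definition reduction_of u phi : Prop :=
  exists D, [/\ is_gcd u D, D != 0 & forall i, tnth u i = D * tnth phi i].

End Parameterizations.

Definition is_algebraic_closure (F : fieldType) (L : closedFieldType)
  (iota : {rmorphism F -> L}) : Prop := forall x, algebraicOver iota x.

(* A ternary quadratic form over an algebraically closed field. *)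
Definition degenerate_conic (L : closedFieldType) (Q : {mpoly L[3]}) : Prop :=
  exists A B, [/\ A \is 1.-homog, B \is 1.-homog & Q = A * B].

Notation X1 := ('X_(0 : 'I_3)).
Notation X2 := ('X_(1 : 'I_3)).
Notation X3 := ('X_(2%:R : 'I_3)).
Notation T1 := ('X_(0 : 'I_2)).
Notation T2 := ('X_(1 : 'I_2)).

(* T1 F2(X) - T2 F1(X), in K[T1,T2][X1,X2,X3] *)
Definition pencil (K : closedFieldType) (F1 F2 : {mpoly K[3]}) :
    {mpoly {mpoly K[2]}[3]} :=
  T1 *: map_mpoly (@mpolyC 2 K) F2 - T2 *: map_mpoly (@mpolyC 2 K) F1.

Definition to_closure (K L : closedFieldType)
    (iota : {rmorphism {fraction {mpoly K[2]}} -> L})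
    (Q : {mpoly {mpoly K[2]}[3]}) : {mpoly L[3]} :=
  map_mpoly (iota \o @tofrac {mpoly K[2]}) Q.

(* Main.v *)
(** The conic G_t : t_1 F_2 - t_2 F_1 = 0 of the pencil passes through
    O = (0 : 0 : 1), and the line through O and (x_1 : x_2 : 0) meets it again in
    a point v(t, x), quadratic in x.  On v(t, x) the forms (F_1, F_2) take the
    value W(t, x) R(x) (t_1, t_2), with R the resultant of F_1 and F_2 with
    respect to X_3 and W linear in t and in x.  The parameterization is
    u(t) = v(t, (a(t), b(t))), so psi o u = id, and P = a(F) X_2 - b(F) X_1
    vanishes on it; C is an irreducible factor of P that vanishes on u.  Where
    P = 0, the point x is on the line through O and (a : b : 0) at t = F(x), so
    that u(F(x)) is proportional to x.

    For the second part, u(F) is proportional to X modulo P, hence a cofactor M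
    of the equation of C in P divides powers of a(F)^2 N and of b(F)^2 N, where
    N = X_1 l_2(F) + X_2 l_3(F) = R(X_1, X_2).  So M = 0 is contained in N = 0, a
    union of lines through O; if M were not constant, one of these lines would
    be a common component of P = 0 and N = 0. *)
Require Import Defs.
From mathcomp Require Import all_boot all_order all_algebra.
From mathcomp Require Import ring zify.
From Stdlib Require Import Classical.
Import GRing.Theory.
Local Open Scope ring_scope.

Set Implicit Arguments.
Unset Strict Implicit.
Unset Printing Implicit Defensive.

(** * Divisibility and congruence of polynomials *)

Section Divisors.
Variables (n : nat) (K : fieldType).
Implicit Types (p q d e : {mpoly K[n]}).

Lemma mdvd_refl p : mdvd p p.
Proof. by exists 1; rewrite mul1r. Qed.

Lemma mdvd0 d : mdvd d 0.
Proof. by exists 0; rewrite mul0r. Qed.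

Lemma mdvd_trans p q e : mdvd p q -> mdvd q e -> mdvd p e.
Proof. by move=> [s ->] [t ->]; exists (t * s); rewrite mulrA. Qed.

Lemma mdvd_mulr d p q : mdvd d p -> mdvd d (p * q).
Proof. by move=> [s ->]; exists (s * q); rewrite mulrAC. Qed.

Lemma mdvd_mull d p q : mdvd d p -> mdvd d (q * p).
Proof. by rewrite mulrC; apply: mdvd_mulr. Qed.

Lemma mdvd_add d p q : mdvd d p -> mdvd d q -> mdvd d (p + q).
Proof. by move=> [s ->] [t ->]; exists (s + t); rewrite mulrDl. Qed.

Lemma mdvd_meval d p (x : 'I_n -> K) : mdvd d p -> d.@[x] = 0 -> p.@[x] = 0.
Proof. by move=> [s ->] d0; rewrite mevalM d0 mulr0. Qed.

Lemma mdvd1_neq0 d (x : 'I_n -> K) : mdvd d 1 -> d.@[x] != 0.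
Proof.
by move=> d1; apply/eqP => /(mdvd_meval d1)/eqP; rewrite meval1 oner_eq0.
Qed.

Lemma mdvd1_unit d : mdvd d 1 <-> d \is a GRing.unit.
Proof.
split=> [[q /esym qd]|ud]; last by exists d^-1; rewrite mulVr.
by apply/unitrP; exists q; rewrite qd mulrC qd.
Qed.

Lemma is_gcd2_mdvd1 p q e : is_gcd [:: p; q] 1 -> mdvd e p -> mdvd e q ->
  mdvd e 1.
Proof.
by move=> [_ pq1] ep eq; apply: pq1 => r; rewrite !inE => /orP[]/eqP->.
Qed.

(** Congruence modulo [d] passes to sums, and to products because [a * a' - b * b' = (a - b) * a' +
    b * (a' - b')]. This yields the factor theorem for linear forms and, later, computations modulo
    [P]. *)
Lemma comp_mpoly_congr m (s s' : m.-tuple {mpoly K[n]}) d (p : {mpoly K[m]}) :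
  (forall i, mdvd d (tnth s i - tnth s' i)) ->
  mdvd d ((p \mPo s) - (p \mPo s')).
Proof.
move=> ds; elim/mpolyind: p => [|c mm p _ _ IH].
  by rewrite !comp_mpoly0 subr0; apply: mdvd0.
rewrite !comp_mpolyD !comp_mpolyZ opprD addrACA -scalerBr.
apply: mdvd_add => //; rewrite -mul_mpolyC; apply: mdvd_mull.
rewrite !comp_mpolyX.
have cM (a b a' b' : {mpoly K[n]}) :
    mdvd d (a - b) -> mdvd d (a' - b') -> mdvd d (a * a' - b * b').
  move=> ab ab'; have -> : a * a' - b * b' = (a - b) * a' + b * (a' - b') by ring.
  by apply: mdvd_add; [apply: mdvd_mulr | apply: mdvd_mull].
elim/big_rec2: _ => [|i y1 y2 _ IH']; first by rewrite subrr; apply: mdvd0.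
apply: (cM) => //; elim: (mm i) => [|k IHk].
  by rewrite !expr0 subrr; apply: mdvd0.
by rewrite !exprS; apply: cM.
Qed.

End Divisors.

(** * Homogeneous polynomials and their factors *)

Section Homogeneous.
Variables (n : nat) (K : fieldType).
Implicit Types (p q : {mpoly K[n]}).

Lemma dhomog_meval d p c (x : 'I_n -> K) : p \is d.-homog ->
  p.@[fun i => c * x i] = c ^+ d * p.@[x].
Proof.
move=> /dhomogP hp; rewrite !mevalE big_distrr /=.
rewrite big_seq [RHS]big_seq; apply: eq_bigr => m mp.
rewrite mulrCA; congr (_ * _).
under eq_bigr do rewrite exprMn.
by rewrite big_split /= prodrXr -mdegE hp.
Qed.

(* [grade p] is p(X_1 Y, ..., X_n Y), so that p is d-homogeneous exactly when
   [grade p] is a monomial of degree d in Y. *)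
Definition grade p : {poly {mpoly K[n]}} :=
  mmap (polyC \o @mpolyC n K) (fun i => ('X_i)%:P * 'X) p.

Lemma gradeM p q : grade (p * q) = grade p * grade q.
Proof. exact: rmorphM. Qed.

Lemma gradeE p :
  grade p = \sum_(m <- msupp p) (p@_m *: 'X_[m])%:P * 'X^(mdeg m).
Proof.
rewrite /grade /mmap; apply: eq_bigr => m _.
rewrite -mul_mpolyC polyCM /= -mulrA; congr (_ * _).
rewrite /mmap1; under eq_bigr do rewrite exprMn -rmorphXn.
by rewrite big_split /= -rmorph_prod -mpolyXE_id prodrXr -mdegE.
Qed.

Lemma horner_grade p : (grade p).[1] = p.
Proof.
rewrite gradeE horner_sum [RHS]mpolyE; apply: eq_bigr => m _.
by rewrite hornerM hornerC hornerXn expr1n mulr1.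
Qed.

Lemma coef_grade p k : (grade p)`_k = pihomog mdeg k p.
Proof.
rewrite gradeE coef_sum pihomogE [RHS]big_mkcond; apply: eq_bigr => m _.
by rewrite coefCM coefXn eq_sym; case: eqP => _; rewrite ?mulr1 ?mulr0.
Qed.

Lemma grade_dhomog p d : p \is d.-homog -> grade p = p%:P * 'X^d.
Proof.
move=> hp; apply/polyP => k; rewrite coef_grade coefCM coefXn.
case: eqP => [->|/eqP kd]; first by rewrite pihomog_dE ?mulr1.
by rewrite mulr0 (pihomog_ne0 _ hp) 1?eq_sym.
Qed.

Lemma dhomog_grade p q d : grade p = q%:P * 'X^d -> p \is d.-homog.
Proof.
move=> pq; have {1}<- : q = p.
  by rewrite -[RHS]horner_grade pq !hornerE expr1n mulr1.
rewrite (_ : q = pihomog mdeg d p) ?pihomogP //.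
by rewrite -coef_grade pq coefCM coefXn eqxx mulr1.
Qed.

(** ['X] is prime: each of its [d] occurrences cancels against [f] or [g], until the product is a
    constant. *)
Lemma poly_monomial_factor (R : idomainType) (f g : {poly R}) c d :
  c != 0 -> f * g = c%:P * 'X^d -> exists k c', f = c'%:P * 'X^k.
Proof.
elim: d f g => [|d IH] f g c0.
  rewrite expr0 mulr1 => fg; have: size (f * g) == 1%N by rewrite fg size_polyC c0.
  rewrite size_mul_eq1 => /andP[/size_poly1P[c' _ ->] _].
  by exists 0%N, c'; rewrite expr0 mulr1.
move=> fg; have: root (f * g) 0 by rewrite fg rootE !hornerE expr0n /= mulr0.
have X0 : ('X : {poly R}) != 0 by rewrite polyX_eq0.
rewrite rootM => /orP[] /factor_theorem[h]; rewrite subr0 => hE.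
  case: (IH h g c0) => [|k [c' hk]].
    by apply: (mulIf X0); rewrite mulrAC -hE fg exprSr mulrA.
  by exists k.+1, c'; rewrite hE hk exprSr mulrA.
by apply: (IH f h c0); apply: (mulIf X0); rewrite -mulrA -hE fg exprSr mulrA.
Qed.

(** [grade] is multiplicative, and over a domain the factors of a monomial in Y are monomials in
    Y. *)
Lemma dhomog_factor p q d : p * q != 0 -> p * q \is d.-homog ->
  exists k, p \is k.-homog.
Proof.
move=> pq0 /grade_dhomog; rewrite gradeM => /(poly_monomial_factor pq0).
by move=> [k [c' /dhomog_grade]]; exists k.
Qed.

Lemma mdvd_dhomog p q d : p != 0 -> p \is d.-homog -> mdvd q p ->
  exists k, q \is k.-homog.
Proof. by move=> p0 + [r pE]; rewrite pE mulrC in p0 * => /(dhomog_factor p0). Qed.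

Lemma dhomog_cofactor p q d k : p != 0 -> p \is k.-homog ->
  p * q \is (k + d).-homog -> q \is d.-homog.
Proof.
move=> p0 hp hpq; have [->|q0] := eqVneq q 0; first exact: dhomog0.
have qp0 : q * p != 0 by rewrite mulf_neq0.
have [|e he] := dhomog_factor (d := k + d) qp0; first by rewrite mulrC.
have: p * q \is (k + e).-homog by apply: dhomogM.
by move/(dhomog_uniq _ hpq); rewrite mulf_neq0 // => /(_ isT)/addnI->.
Qed.

Lemma dhomog0_const p : p \is 0.-homog -> p = (p@_0%MM)%:MP.
Proof.
move=> /dhomogP hp; apply: msize1_polyC; rewrite msizeE.
by apply/bigmax_leqP_seq => m /hp ->.
Qed.

Lemma dhomog0_unit p : p != 0 -> p \is 0.-homog -> p \is a GRing.unit.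
Proof.
move=> p0 /dhomog0_const pE; rewrite pE in p0 *; apply/mdvd1_unit.
exists (p@_0%MM)^-1%:MP; rewrite -mpolyCM mulVf ?mpolyC1 //.
by apply: contraNneq p0 => ->; rewrite mpolyC0.
Qed.

End Homogeneous.

Lemma dhomog1E (R : nzRingType) n (p : {mpoly R[n]}) : p \is 1.-homog ->
  p = \sum_i p@_U_(i) *: 'X_i.
Proof.
move=> /dhomogP hp; apply/mpolyP => m; rewrite raddf_sum /=.
under eq_bigr do rewrite linearZ /= mcoeffX.
have [/eqP/mdeg1P[i /eqP->]|mN1] := eqVneq (mdeg m) 1%N.
  rewrite (bigD1 i) //= eqxx mulr1 big1 ?addr0 // => j ji.
  case: eqP => [|_]; last by rewrite mulr0.
  by move/mnmP/(_ i); rewrite !mnmE eqxx (negPf ji).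
rewrite big1 => [|i _].
  by apply/eqP; rewrite mcoeff_eq0; apply: contra mN1 => /hp->.
by case: eqP => [E|_]; rewrite ?mulr0 //; rewrite -E mdeg1 eqxx in mN1.
Qed.

(** * Polynomials as functions over an algebraically closed field *)

Section Infinite.
Variable K : closedFieldType.

Lemma meval_muni n (p : {mpoly K[n.+1]}) (x : 'I_n.+1 -> K) :
  p.@[x] = (map_poly (meval (fun i => x (widen_ord (leqnSn n) i))) (muni p)).[x ord_max].
Proof.
rewrite muniE mevalE rmorph_sum horner_sum; apply: eq_bigr => m _ /=.
rewrite map_polyZ /= map_polyXn /= hornerZ hornerXn mevalZ mevalX -mulrA big_ord_recr /=.
by congr (_ * (_ * _)); apply: eq_bigr => i _; rewrite mnmE.
Qed.

(** A monomial is determined by its last exponent and the remaining ones, so the leading coefficient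
    of a nonzero [p] survives as a coefficient of [muni p]. *)
Lemma muni_eq0 (n : nat) (p : {mpoly K[n.+1]}) : muni p = 0 -> p = 0.
Proof.
move=> p0; apply/eqP; apply: contraTT isT => pN0.
have := mleadc_eq0 p; rewrite (negPf pN0); move: (mlead p) => m /negP[].
have /(congr1 (fun f : {poly {mpoly K[n]}} =>
  f`_(m ord_max)@_[multinom m (widen_ord (leqnSn n) i) | i < n])) := p0.
rewrite coef0 mcoeff0 muniE coef_sum raddf_sum /= => /eqP.
have [mp|] := boolP (m \in msupp p); last by rewrite mcoeff_eq0.
rewrite (bigD1_seq m) ?msupp_uniq //= big1 => [|m' m'm].
  by rewrite coefZ coefXn eqxx mulr1 mcoeffZ mcoeffX eqxx mulr1 addr0.
rewrite coefZ coefXn; case: eqP => [e1|_]; last by rewrite mulr0 mcoeff0.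
rewrite mulr1 mcoeffZ mcoeffX; case: eqP => [e2|_]; last by rewrite mulr0.
case/eqP: m'm; apply/mnmP => i.
have [j ->|->] := unliftP ord_max i; last exact/esym.
move/mnmP/(_ j): e2; rewrite !mnmE.
rewrite (_ : widen_ord _ j = lift ord_max j) //.
by apply/val_inj; rewrite /= /bump leqNgt ltn_ord.
Qed.

(** Induction on [n]: at a point where the leading coefficient in the last variable is nonzero, [p]
    becomes a nonzero univariate polynomial, which has a nonroot. *)
Lemma meval_neq0 n (p : {mpoly K[n]}) : p != 0 -> exists x, p.@[x] != 0.
Proof.
elim: n p => [|n IH] p p0.
  have pE : p = (p@_0%MM)%:MP.
    apply: msize1_polyC; rewrite msizeE; apply/bigmax_leqP_seq => m _ _.
    by rewrite mdegE big_ord0.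
  exists (fun=> 0); rewrite pE mevalC; apply: contraNneq p0 => c0.
  by rewrite pE c0 mpolyC0.
have [x fx0] : exists x, (lead_coef (muni p)).@[x] != 0.
  by apply: IH; rewrite lead_coef_eq0; apply: contraNneq p0 => /muni_eq0->.
have /closed_nonrootP[y] : map_poly (meval x) (muni p) != 0.
  apply: contraNneq fx0 => f0; rewrite lead_coefE -coef_map.
  by rewrite [map_poly _ _]f0 coef0.
pose z i := if unlift ord_max i is Some j then x j else y.
rewrite rootE => fy0; exists z; rewrite meval_muni /z unlift_none.
congr (_.[_] != 0): fy0; apply: eq_map_poly => q.
apply: meval_eq => i; rewrite (_ : widen_ord _ i = lift ord_max i) ?liftK //.
by apply/val_inj; rewrite /= /bump leqNgt ltn_ord.
Qed.

Lemma meval_ext n (p q : {mpoly K[n]}) : (forall x, p.@[x] = q.@[x]) -> p = q.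
Proof.
move=> pq; apply/eqP; rewrite -subr_eq0; apply: contraT => /meval_neq0[x].
by rewrite mevalB pq subrr eqxx.
Qed.

End Infinite.

(** * Linear forms in two of the variables *)

Section LinearForms.
Variables (n : nat) (K : closedFieldType).
Implicit Types (i j : 'I_n) (f : {mpoly K[n]}).

Definition linform i j (al be : K) : {mpoly K[n]} := be *: 'X_i - al *: 'X_j.

Lemma linform_homog i j al be : linform i j al be \is 1.-homog.
Proof. by rewrite rpredB // rpredZ // dhomogX /= mdeg1. Qed.

Lemma meval_linform i j al be (x : 'I_n -> K) :
  (linform i j al be).@[x] = be * x i - al * x j.
Proof. by rewrite mevalB !mevalZ !mevalXU. Qed.

(** Solving the linear equation for ['X_i] gives a substitution [s] that kills [f] and is congruent
    to the identity modulo the linear form. *)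
Lemma linform_dvd i j al be f : i != j -> (al != 0) || (be != 0) ->
    (forall x, be * x i = al * x j -> f.@[x] = 0) ->
  mdvd (linform i j al be) f.
Proof.
(* Exchanging [i] with [j] and [al] with [be] only changes the sign of the form. *)
wlog be0 : i j al be / be != 0 => [wl|] ij ab fx.
  have [be0|] := eqVneq be 0; last by move=> be0; apply: wl.
  rewrite be0 eqxx orbF in ab.
  have [|||q ->] := wl j i be al ab; rewrite ?ab ?orbT 1?eq_sym //.
    by move=> x /esym; apply: fx.
  by exists (- q); rewrite /linform !(mulrBr, mulNr); ring.
pose s := [tuple if k == i then (al / be) *: 'X_j else 'X_k : {mpoly K[n]} | k < n].
have fs0 : f \mPo s = 0.
  apply: meval_ext => x; rewrite meval0 comp_mpoly_meval; apply: fx.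
  rewrite !tnth_mktuple eqxx eq_sym (negPf ij) mevalZ !mevalXU.
  by rewrite mulrA mulrCA divff ?mulr1.
rewrite -[f]subr0 -fs0 -{1}[f]comp_mpoly_id; apply: comp_mpoly_congr => k.
rewrite !tnth_mktuple; case: eqP => [->|_]; last by rewrite subrr; apply: mdvd0.
exists (be^-1)%:MP; rewrite mul_mpolyC /linform scalerBr !scalerA mulVf // scale1r.
by rewrite [be^-1 * _]mulrC.
Qed.

End LinearForms.

(** * Binary forms: roots, common factors, reduction *)

Section BinaryForms.
Variable K : closedFieldType.
Implicit Types (f g e D : {mpoly K[2]}) (t : 'I_2 -> K).

Lemma horner_mmap n (h : 'I_n -> {poly K}) (f : {mpoly K[n]}) z :
  (mmap polyC h f).[z] = f.@[fun i => (h i).[z]].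
Proof.
rewrite mevalE /mmap horner_sum; apply: eq_bigr => m _.
rewrite hornerM hornerC /mmap1 horner_prod; congr (_ * _).
by apply: eq_bigr => i _; rewrite horner_exp.
Qed.

Definition pt2 (a b : K) : 'I_2 -> K := fun i => if i == 0 then a else b.

Lemma pt2E t : t =1 pt2 (t 0) (t 1).
Proof.
move=> i; rewrite /pt2; case: eqP => [->//|/eqP].
by case: i => [[|[|k]] hk] //= _; congr t; apply: val_inj.
Qed.

Definition nonzero2 t := (t 0 != 0) || (t 1 != 0).

Lemma proportional2 t x : nonzero2 t -> t 1 * x 0 = t 0 * x 1 ->
  exists c, x =1 (fun i => c * t i).
Proof.
move=> t0 xt.
have [t00|t00] := eqVneq (t 0) 0.
  rewrite /nonzero2 t00 eqxx /= in t0.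
  have x0 : x 0 = 0.
    by apply/eqP; move/eqP: xt; rewrite t00 mul0r mulf_eq0 (negPf t0).
  exists (x 1 / t 1) => i; rewrite [LHS]pt2E [t i]pt2E /pt2.
  by case: eqP => _; rewrite ?x0 ?t00 ?mulr0 // mulfVK.
exists (x 0 / t 0) => i; rewrite [LHS]pt2E [t i]pt2E /pt2.
case: eqP => _; first by rewrite mulfVK.
by apply: (mulfI t00); rewrite -xt; field.
Qed.

(** For nonzero [t], this is the equation of the point [t] of the projective line. *)
Definition lin2 t : {mpoly K[2]} := linform 0 1 (t 0) (t 1).

Lemma form_root_dvd f d t : f \is d.-homog -> nonzero2 t -> f.@[t] = 0 ->
  mdvd (lin2 t) f.
Proof.
move=> hf t0 ft; apply: linform_dvd => // x xt.
have [c xE] := proportional2 t0 xt.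
by rewrite (meval_eq _ xE) (dhomog_meval _ _ hf) ft mulr0.
Qed.

Lemma linform_neq0 t : nonzero2 t -> lin2 t != 0.
Proof.
apply: contraTneq => l0; rewrite /nonzero2.
have := congr1 (meval (pt2 1 0)) l0; rewrite meval_linform meval0 /= mulr0 subr0 mulr1.
have := congr1 (meval (pt2 0 1)) l0.
rewrite meval_linform meval0 /= mulr0 sub0r mulr1 => /eqP.
by rewrite oppr_eq0 => -> ->; rewrite eqxx.
Qed.

Lemma form_root_factor f d t : f \is d.+1.-homog -> nonzero2 t -> f.@[t] = 0 ->
  exists2 g, g \is d.-homog & f = lin2 t * g.
Proof.
move=> hf t0 ft; have [g fE] := form_root_dvd hf t0 ft.
rewrite mulrC in fE; exists g => //.
by apply: (dhomog_cofactor (linform_neq0 t0) (linform_homog _ _ _ _)); rewrite -fE.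
Qed.

(** Dehomogenise: either [p] has a root, or [p] is a nonzero constant and [f] is a multiple of a
    power of the second variable, with root (1 : 0). *)
Lemma form_has_root f d : f \is d.-homog -> (0 < d)%N ->
  exists2 t, nonzero2 t & f.@[t] = 0.
Proof.
move=> hf d0; pose p := mmap polyC (fun i : 'I_2 => if i == 0 then 'X else 1) f.
have pE z : p.[z] = f.@[pt2 z 1].
  rewrite horner_mmap; apply: meval_eq => i; rewrite /pt2.
  by case: eqP => _; rewrite !hornerE.
have [sp|/closed_rootP[z /rootP pz]] := eqVneq (size p) 1%N; last first.
  by exists (pt2 z 1); rewrite -?pE // /nonzero2 /= oner_eq0 orbT.
move/eqP/size_poly1P: sp => [c _ pc].
suff fE : f = c *: 'X_1 ^+ d.
  exists (pt2 1 0); first by rewrite /nonzero2 /= oner_eq0.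
  by rewrite fE mevalZ rmorphXn /= mevalXU /= expr0n eqn0Ngt d0 mulr0.
(* Multiplying by the second variable makes the points with [x 1 = 0] trivial; the others are scaled
   to second coordinate 1. *)
have X0 : ('X_1 : {mpoly K[2]}) != 0 by rewrite -msize_poly_eq0 msizeX mdeg1.
apply: (mulIf X0); apply: meval_ext => x.
rewrite !mevalM mevalZ rmorphXn /= !mevalXU.
have [->|x10] := eqVneq (x 1) 0; first by rewrite !mulr0.
have xE : x =1 (fun i => x 1 * pt2 (x 0 / x 1) 1 i).
  by move=> i; rewrite [LHS]pt2E /pt2; case: eqP => _; field.
by rewrite (meval_eq _ xE) (dhomog_meval _ _ hf) -pE pc hornerC; ring.
Qed.

(** For forms over an algebraically closed field this amounts to having no common factor. *)
Definition no_common_zero m (f : 'I_m -> {mpoly K[2]}) :=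
  forall t, nonzero2 t -> exists i, (f i).@[t] != 0.

(** Euclid's lemma, by induction on the degree of [e]: at a root of [e] some [f i] is nonzero, so
    [D] vanishes there too, and the linear factor cancels. *)
Lemma form_gauss m (f : 'I_m -> {mpoly K[2]}) e k D l : no_common_zero f ->
    e != 0 -> e \is k.-homog -> D \is l.-homog ->
    (forall i, mdvd e (f i * D)) ->
  mdvd e D.
Proof.
move=> fz; elim: k e D l => [|k IH] e D l e0 he hD eD.
  apply: mdvd_trans (_ : mdvd 1 D); last by exists D; rewrite mulr1.
  exact/mdvd1_unit/dhomog0_unit.
have [t t0 et] := form_has_root he isT.
have [i fi] := fz t t0.
have Dt : D.@[t] = 0.
  have [q /(congr1 (meval t))] := eD i; rewrite !mevalM et mulr0 => /eqP.
  by rewrite mulf_eq0 (negPf fi) => /eqP.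
have L0 := linform_neq0 t0.
have [e' he' eE] := form_root_factor he t0 et.
have [->|D0] := eqVneq D 0; first exact: mdvd0.
case: l hD => [|l] hD.
  move: D0 Dt; rewrite (dhomog0_const hD) mevalC => + c0.
  by rewrite c0 mpolyC0 eqxx.
have [D' hD' DE] := form_root_factor hD t0 Dt.
have e'0 : e' != 0 by apply: contraNneq e0 => e'0; rewrite eE e'0 mulr0.
have [j|q qE] := IH e' D' l e'0 he' hD'.
  have [q qE] := eD j; exists q; apply: (mulfI L0).
  by rewrite mulrCA -DE qE eE mulrCA.
by exists q; rewrite DE eE qE mulrCA.
Qed.

(** While there is a common zero, its linear form is divided out of all [f i]. This stops at degree
    0 at the latest, where the nonzero form is a constant. *)
Lemma form_reduction m (f : 'I_m -> {mpoly K[2]}) d i0 :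
    (forall i, f i \is d.-homog) -> f i0 != 0 ->
  exists k l D (g : 'I_m -> {mpoly K[2]}),
    [/\ D \is k.-homog, D != 0, forall i, g i \is l.-homog,
        forall i, f i = D * g i & no_common_zero g].
Proof.
elim: d f => [|d IH] f hf fi0.
  exists 0%N, 0%N, 1, f; split=> //; rewrite ?oner_eq0 ?dhomog1 //.
  - by move=> i; rewrite mul1r.
  move=> t _; exists i0; move: fi0; rewrite (dhomog0_const (hf i0)) mevalC.
  by apply: contraNneq => ->; rewrite mpolyC0.
have [fz|fz] := classic (no_common_zero f).
  exists 0%N, d.+1, 1, f; split=> //; rewrite ?oner_eq0 ?dhomog1 //.
  by move=> i; rewrite mul1r.
have [t [t0 ft]] : exists t, nonzero2 t /\ forall i, (f i).@[t] = 0.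
  apply: NNPP => nt; apply: fz => t t0; apply: NNPP => ni; apply: nt.
  exists t; split=> // i; apply/eqP; apply: contraT => fi.
  by case: ni; exists i.
have /fin_all_exists2[g hg fE] i := form_root_factor (hf i) t0 (ft i).
have [|k [l [D [h [hD D0 hh gE hz]]]]] := IH g hg.
  by apply: contraNneq fi0 => g0; rewrite fE g0 mulr0.
exists (1 + k)%N, l, (lin2 t * D), h; split=> //.
- by rewrite dhomogM // linform_homog.
- by rewrite mulf_neq0 // linform_neq0.
by move=> i; rewrite fE gE mulrA.
Qed.

(** A common divisor [e] of the [D * g i] is itself a form, so that [form_gauss] cancels the
    [g i]. *)
Lemma no_common_zero_gcd m (u : m.-tuple {mpoly K[2]}) D k l
    (g : 'I_m -> {mpoly K[2]}) i0 :
    D \is k.-homog -> (forall i, g i \is l.-homog) ->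
    (forall i, tnth u i = D * g i) -> no_common_zero g -> tnth u i0 != 0 ->
  is_gcd u D.
Proof.
move=> hD hg uE gz u0; split=> [p /tnthP[i ->]|e eu].
  by exists (g i); rewrite uE mulrC.
have eui := eu _ (mem_tnth _ u).
have [j he] : exists j, e \is j.-homog.
  have hu : tnth u i0 \is (k + l).-homog by rewrite uE; apply: dhomogM.
  exact: mdvd_dhomog u0 hu (eui i0).
apply: form_gauss gz _ he hD _ => [|i]; last by rewrite mulrC -uE.
by have [q qE] := eui i0; apply: contraNneq u0 => e0; rewrite qE e0 mulr0.
Qed.

Lemma coprime_no_common_zero f g d : f \is d.-homog -> g \is d.-homog ->
  is_gcd [:: f; g] 1 -> forall t, nonzero2 t -> (f.@[t] != 0) || (g.@[t] != 0).
Proof.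
move=> hf hg fg t t0; rewrite -negb_and; apply/negP => /andP[/eqP ft /eqP gt].
have := is_gcd2_mdvd1 fg (form_root_dvd hf t0 ft) (form_root_dvd hg t0 gt).
by move/(mdvd1_neq0 t); rewrite meval_linform mulrC subrr eqxx.
Qed.

End BinaryForms.

(** * Irreducible factors, composition of forms, points in coordinates *)

(** The kernel of [ev] is prime, so it contains one factor of any factorization of [P]; descend on
    [msize]. With [ev] the composition with a parameterization, [Q] is the equation of its image. *)
Lemma irreducible_factor (K : fieldType) n (R : idomainType)
    (ev : {rmorphism {mpoly K[n]} -> R}) (P : {mpoly K[n]}) :
    P != 0 -> ev P = 0 ->
  exists Q, [/\ mirreducible Q, mdvd Q P & ev Q = 0].
Proof.
have [k] := ubnP (msize P); elim: k P => // k IH P sP P0 evP.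
have PNu : P \isn't a GRing.unit.
  by apply/negP => /(rmorph_unit ev); rewrite evP unitr0.
have [irr|irr] := classic
    (forall q r, P = q * r -> q \is a GRing.unit \/ r \is a GRing.unit).
  by exists P; split=> //; apply: mdvd_refl.
have [q [r [PE qNu rNu]]] :
    exists q r, [/\ P = q * r, q \isn't a GRing.unit & r \isn't a GRing.unit].
  apply: NNPP => nqr; apply: irr => q r PE.
  have [qu|qNu] := boolP (q \is a GRing.unit); [by left | right].
  by apply: contraT => rNu; case: nqr; exists q, r.
have [q0 r0] : q != 0 /\ r != 0 by apply/andP; rewrite -negb_or -mulf_eq0 -PE.
have big (p : {mpoly K[n]}) : p != 0 -> p \isn't a GRing.unit -> (1 < msize p)%N.
  move=> p0; rewrite ltnNge; apply: contra => /msize1_polyC pE.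
  have c0 : p@_0%MM != 0 by apply: contraNneq p0 => c0; rewrite pE c0 mpolyC0.
  rewrite pE; apply/unitrP; exists (p@_0%MM)^-1%:MP.
  by rewrite -!mpolyCM mulVf ?mulfV ?mpolyC1.
have := big q q0 qNu; have := big r r0 rNu.
move: sP evP; rewrite PE msizeM // rmorphM /= => sP /eqP; rewrite mulf_eq0.
move=> /orP[] /eqP ev0 sr sq.
  have qk : (msize q < k)%N.
    by move: sP sr sq; move: (msize q) (msize r) => x y; lia.
  have [Q [irrQ Qq evQ]] := IH q qk q0 ev0.
  by exists Q; split=> //; apply: mdvd_mulr.
have rk : (msize r < k)%N.
  by move: sP sr sq; move: (msize q) (msize r) => x y; lia.
have [Q [irrQ Qr evQ]] := IH r rk r0 ev0.
by exists Q; split=> //; apply: mdvd_mull.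
Qed.

Lemma dhomog_comp (K : fieldType) m n (p : {mpoly K[m]})
    (s : m.-tuple {mpoly K[n]}) d e :
  p \is d.-homog -> (forall i, tnth s i \is e.-homog) ->
  p \mPo s \is (d * e).-homog.
Proof.
move=> /dhomogP hp hs; rewrite comp_mpolyEX big_seq rpred_sum // => mm mp.
rewrite rpredZ // comp_mpolyX -(hp _ mp) /= mdegE big_distrl /=.
elim/big_rec2: _ => [|i y1 k _ IH]; first exact: dhomog1.
by apply: dhomogM IH; rewrite mulnC; apply: dhomogMn.
Qed.

Lemma dhomog_meval_neq0 (K : fieldType) n (p : {mpoly K[n]}) d (x : 'I_n -> K) :
  p \is d.+1.-homog -> p.@[x] != 0 -> exists i, x i != 0.
Proof.
move=> hp px; apply/existsP; apply: contraNT px; rewrite negb_exists => /forallP x0.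
have xE : x =1 (fun i => 0 * x i).
  by move=> i; rewrite mul0r; apply/eqP; rewrite -[_ == _]negbK x0.
by rewrite (meval_eq _ xE) (dhomog_meval _ _ hp) exprS !mul0r.
Qed.

Lemma form_neq0_nonzero2 (K : closedFieldType) (p : {mpoly K[2]}) d x :
  p \is d.+1.-homog -> p.@[x] != 0 -> nonzero2 x.
Proof.
move=> hp px; have [i] := dhomog_meval_neq0 hp px.
by rewrite (pt2E x i) /pt2 /nonzero2; case: ifP => _ ->; rewrite ?orbT.
Qed.

Section Points.
Variable K : closedFieldType.

Definition pt3 (a b c : K) : 'I_3 -> K :=
  fun i => if i == 0 then a else if i == 1 then b else c.

Lemma pt2_coord (a b : K) : (pt2 a b 0 = a) * (pt2 a b 1 = b).
Proof. by []. Qed.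

Lemma pt3_coord a b c :
  (pt3 a b c 0 = a) * (pt3 a b c 1 = b) * (pt3 a b c 2%:R = c).
Proof. by []. Qed.

Lemma pt3E (x : 'I_3 -> K) : x =1 pt3 (x 0) (x 1) (x 2%:R).
Proof.
move=> i; rewrite /pt3; case: eqP => [->//|/eqP]; case: eqP => [->//|/eqP].
by case: i => [[|[|[|k]]] hk] //= _ _; congr x; apply: val_inj.
Qed.

Lemma meval_comp2 n (p : {mpoly K[2]}) (f g : {mpoly K[n]}) x :
  (p \mPo [tuple f; g]).@[x] = p.@[pt2 f.@[x] g.@[x]].
Proof. by rewrite comp_mpoly_meval; apply/meval_eq/(pt2E (fun i => (tnth _ i).@[x])). Qed.

Lemma meval_comp3 n (p : {mpoly K[3]}) (f g h : {mpoly K[n]}) x :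
  (p \mPo [tuple f; g; h]).@[x] = p.@[pt3 f.@[x] g.@[x] h.@[x]].
Proof. by rewrite comp_mpoly_meval; apply/meval_eq/(pt3E (fun i => (tnth _ i).@[x])). Qed.

Lemma dhomog_meval2 (p : {mpoly K[2]}) d c a b : p \is d.-homog ->
  p.@[pt2 (c * a) (c * b)] = c ^+ d * p.@[pt2 a b].
Proof.
move=> hp; rewrite -(dhomog_meval _ _ hp); apply: meval_eq => i.
by rewrite /pt2; case: eqP.
Qed.

Lemma dhomog_meval3 (p : {mpoly K[3]}) d c x y z : p \is d.-homog ->
  p.@[pt3 (c * x) (c * y) (c * z)] = c ^+ d * p.@[pt3 x y z].
Proof.
move=> hp; rewrite -(dhomog_meval _ _ hp); apply: meval_eq => i.
by rewrite /pt3; do 2?case: eqP => // _.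
Qed.

Lemma meval_dhomog1 (l : {mpoly K[2]}) t : l \is 1.-homog ->
  l.@[t] = l.@[pt2 1 0] * t 0 + l.@[pt2 0 1] * t 1.
Proof.
move=> /dhomog1E->; rewrite !big_ord_recl big_ord0 addr0.
rewrite !mevalD !mevalZ !mevalXU.
have -> : lift ord0 ord0 = 1 :> 'I_2 by apply: val_inj.
by rewrite [ord0]/(0 : 'I_2) !pt2_coord !mulr1 !mulr0 addr0 add0r.
Qed.

End Points.

Lemma ord3_ind (T : 'I_3 -> Prop) : T 0 -> T 1 -> T 2%:R -> forall i, T i.
Proof.
move=> T0 T1 T2 [[|[|[|i]]] hi] //.
- by rewrite (_ : Ordinal hi = 0) //; apply: val_inj.
- by rewrite (_ : Ordinal hi = 1) //; apply: val_inj.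
by rewrite (_ : Ordinal hi = 2%:R) //; apply: val_inj.
Qed.

Lemma tnth3 T (x y z : T) : (tnth [tuple x; y; z] 0 = x) *
  (tnth [tuple x; y; z] 1 = y) * (tnth [tuple x; y; z] 2%:R = z).
Proof. by []. Qed.

(** Both terms of each difference are values of one quadratic map: at (c x1, c x2) the last two
    hypotheses turn its value into [- (c ^+ 2 * N)] times (x1, x2, x3), and at (z A, z B) a factor
    [z ^+ 2] comes out. Congruent arguments have congruent values. *)
Lemma conic_pt_congr n (K : fieldType)
    (p A B L1 L2 L3 L4 L5 N c z x1 x2 x3 : {mpoly K[n]}) :
    mdvd p (c * x1 - z * A) -> mdvd p (c * x2 - z * B) ->
    N = x1 * L2 + x2 * L3 ->
    - (N * x3) = x1 * x2 * L1 + x1 ^+ 2 * L4 + x2 ^+ 2 * L5 ->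
  [/\ mdvd p (- (c ^+ 2 * N) * x1 - z ^+ 2 * (- A * (A * L2 + B * L3))),
      mdvd p (- (c ^+ 2 * N) * x2 - z ^+ 2 * (- B * (A * L2 + B * L3))) &
      mdvd p (- (c ^+ 2 * N) * x3
              - z ^+ 2 * (A * B * L1 + A ^+ 2 * L4 + B ^+ 2 * L5))].
Proof.
move=> [g1 E1] [g2 E2] NE Nx3.
have {}E1 : c * x1 = g1 * p + z * A by rewrite -E1 subrK.
have {}E2 : c * x2 = g2 * p + z * B by rewrite -E2 subrK.
split.
- exists (- g1 * (c * x1 * L2 + c * x2 * L3) - z * A * (g1 * L2 + g2 * L3)).
  transitivity (- (c * x1) * (c * x1 * L2 + c * x2 * L3)
                + z * A * (z * A * L2 + z * B * L3)); first by rewrite NE; ring.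
  by rewrite E1 E2; ring.
- exists (- g2 * (c * x1 * L2 + c * x2 * L3) - z * B * (g1 * L2 + g2 * L3)).
  transitivity (- (c * x2) * (c * x1 * L2 + c * x2 * L3)
                + z * B * (z * A * L2 + z * B * L3)); first by rewrite NE; ring.
  by rewrite E1 E2; ring.
exists (g1 * (c * x2) * L1 + z * A * g2 * L1 + g1 * (c * x1 + z * A) * L4
        + g2 * (c * x2 + z * B) * L5).
transitivity (c ^+ 2 * (- (N * x3)) - z ^+ 2 * (A * B * L1 + A ^+ 2 * L4 + B ^+ 2 * L5)).
  by ring.
transitivity ((c * x1) * (c * x2) * L1 + (c * x1) ^+ 2 * L4 + (c * x2) ^+ 2 * L5
  - z ^+ 2 * (A * B * L1 + A ^+ 2 * L4 + B ^+ 2 * L5)); first by rewrite Nx3; ring.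
by rewrite E1 E2; ring.
Qed.

Lemma comp_mpolyM (K : fieldType) m n (s : m.-tuple {mpoly K[n]}) p q :
  (p * q) \mPo s = (p \mPo s) * (q \mPo s).
Proof. exact: rmorphM. Qed.

(** * The pencil of conics and its resultant *)

Section Pencil.
Variables (K : closedFieldType) (F1 F2 : {mpoly K[3]}).
Variables (l1 l2 l3 l4 l5 : {mpoly K[2]}).
Hypotheses (hF1 : F1 \is 2.-homog) (hF2 : F2 \is 2.-homog).
Hypothesis hF : is_gcd [:: F1; F2] 1.
Hypotheses (hl1 : l1 \is 1.-homog) (hl2 : l2 \is 1.-homog)
  (hl3 : l3 \is 1.-homog) (hl4 : l4 \is 1.-homog) (hl5 : l5 \is 1.-homog).
(** The pencil in evaluated form; nondegeneracy of the generic conic enters through [hl23]. *)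
Hypothesis hG : forall (t : 'I_2 -> K) (x : 'I_3 -> K), t 0 * F2.@[x] - t 1 * F1.@[x] =
  l1.@[t] * (x 0 * x 1) + l2.@[t] * (x 0 * x 2%:R) + l3.@[t] * (x 1 * x 2%:R)
  + l4.@[t] * x 0 ^+ 2 + l5.@[t] * x 1 ^+ 2.
Hypothesis hl23 : (l2 != 0) || (l3 != 0).

(* F_i = X_3 m_i(X_1, X_2) + q_i(X_1, X_2) *)
Definition lin_part t : {mpoly K[2]} := l2.@[t] *: T1 + l3.@[t] *: T2.
Definition quad_part t : {mpoly K[2]} :=
  l1.@[t] *: (T1 * T2) + l4.@[t] *: T1 ^+ 2 + l5.@[t] *: T2 ^+ 2.
(** The pencil is [- F1] at [t] = (0, 1) and [F2] at [t] = (1, 0), whence the signs. *)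
Local Notation m1 := (- lin_part (pt2 0 1)).
Local Notation m2 := (lin_part (pt2 1 0)).
Local Notation q1 := (- quad_part (pt2 0 1)).
Local Notation q2 := (quad_part (pt2 1 0)).

(* the resultant of F1 and F2 with respect to X_3 *)
Definition resultant3 := m2 * q1 - m1 * q2.

Lemma lin_part_homog t : lin_part t \is 1.-homog.
Proof. by rewrite rpredD // rpredZ // dhomogX /= mdeg1. Qed.

Lemma quad_part_homog t : quad_part t \is 2.-homog.
Proof.
have hT (i : 'I_2) : ('X_i : {mpoly K[2]}) \is 1.-homog by rewrite dhomogX /= mdeg1.
have h12 : (T1 : {mpoly K[2]}) * T2 \is 2.-homog by exact: dhomogM (hT 0) (hT 1).
have hTX (i : 'I_2) : ('X_i : {mpoly K[2]}) ^+ 2 \is 2.-homog.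
  exact: (dhomogMn 2 (hT i)).
by rewrite !rpredD // rpredZ.
Qed.

Lemma resultant3_homog : resultant3 \is 3.-homog.
Proof.
have hM t s : lin_part t * quad_part s \is 3.-homog.
  exact: dhomogM (lin_part_homog t) (quad_part_homog s).
by rewrite /resultant3 mulrN mulNr; apply: rpredB; rewrite rpredN; apply: hM.
Qed.

Lemma meval_lin_part t x : (lin_part t).@[x] = l2.@[t] * x 0 + l3.@[t] * x 1.
Proof. by rewrite mevalD !mevalZ !mevalXU. Qed.

Lemma meval_quad_part t x :
  (quad_part t).@[x] = l1.@[t] * (x 0 * x 1) + l4.@[t] * x 0 ^+ 2 + l5.@[t] * x 1 ^+ 2.
Proof. by rewrite !mevalD !mevalZ mevalM !rmorphXn /= !mevalXU. Qed.

Lemma meval_F1 x :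
  F1.@[x] = x 2%:R * m1.@[pt2 (x 0) (x 1)] + q1.@[pt2 (x 0) (x 1)].
Proof.
have := hG (pt2 0 1) x; rewrite !pt2_coord mul0r mul1r sub0r => /eqP.
rewrite eqr_oppLR => /eqP ->.
by rewrite !mevalN meval_lin_part meval_quad_part !pt2_coord; ring.
Qed.

Lemma meval_F2 x :
  F2.@[x] = x 2%:R * m2.@[pt2 (x 0) (x 1)] + q2.@[pt2 (x 0) (x 1)].
Proof.
have := hG (pt2 1 0) x; rewrite !pt2_coord mul0r mul1r subr0 => ->.
by rewrite meval_lin_part meval_quad_part !pt2_coord; ring.
Qed.

Lemma lin_partE t x : (lin_part t).@[x] = t 0 * m2.@[x] - t 1 * m1.@[x].
Proof.
rewrite mevalN !meval_lin_part (meval_dhomog1 t hl2) (meval_dhomog1 t hl3).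
by ring.
Qed.

Lemma quad_partE t x : (quad_part t).@[x] = t 0 * q2.@[x] - t 1 * q1.@[x].
Proof.
rewrite mevalN !meval_quad_part (meval_dhomog1 t hl1) (meval_dhomog1 t hl4)
  (meval_dhomog1 t hl5).
by ring.
Qed.

(* The residual intersection of the conic of parameter t with the line through
   (0 : 0 : 1) and (x_0 : x_1 : 0). *)
Definition conic_pt (t x : 'I_2 -> K) : 'I_3 -> K :=
  pt3 (- x 0 * (lin_part t).@[x]) (- x 1 * (lin_part t).@[x]) (quad_part t).@[x].

(** Let W and S be [lin_part] and [quad_part] at (t, x). On v the form F_i equals W (W q_i - S m_i),
    and inserting W = t_1 m_2 - t_2 m_1 and S = t_1 q_2 - t_2 q_1 leaves W R t_i. *)
Lemma conic_ptE t x :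
  (F1.@[conic_pt t x] = (lin_part t).@[x] * resultant3.@[x] * t 0) *
  (F2.@[conic_pt t x] = (lin_part t).@[x] * resultant3.@[x] * t 1).
Proof.
rewrite meval_F1 meval_F2 /conic_pt !pt3_coord.
have hm1 : m1 \is 1.-homog by rewrite rpredN lin_part_homog.
have hq1 : q1 \is 2.-homog by rewrite rpredN quad_part_homog.
set w := (lin_part t).@[x].
rewrite -[- x 0 * w]mulrC -[- x 1 * w]mulrC ![w * - _]mulrN -![- (w * _)]mulNr.
rewrite (dhomog_meval2 _ _ _ hm1) (dhomog_meval2 _ _ _ hq1).
rewrite (dhomog_meval2 _ _ _ (lin_part_homog _)).
rewrite (dhomog_meval2 _ _ _ (quad_part_homog _)).
rewrite -!(meval_eq _ (pt2E x)) /w quad_partE lin_partE mevalB !mevalM.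
by split; ring.
Qed.

(** If R = 0, the pairs (m_1, m_2) and (q_1, q_2) are proportional: m_i = D g_i and q_i = h g_i with
    g_1, g_2 coprime. Then X_3 D + h is a common factor of F_1 and F_2. *)
Lemma resultant3_neq0 : resultant3 != 0.
Proof.
apply/eqP => r0.
pose m i := if i == 0 :> 'I_2 then m1 else m2.
pose q i := if i == 0 :> 'I_2 then q1 else q2.
have hm i : m i \is 1.-homog.
  by rewrite /m; case: eqP => _; rewrite ?rpredN lin_part_homog.
have hq i : q i \is 2.-homog.
  by rewrite /q; case: eqP => _; rewrite ?rpredN quad_part_homog.
have [i0 mi0] : exists i, m i != 0.
  apply/existsP; apply: contraTT hl23; rewrite negb_exists => /forallP m0.
  have /negbNE/eqP m10 := m0 0; have /negbNE/eqP m20 := m0 1.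
  have lz (x : 'I_2 -> K) t : l2.@[t] * x 0 + l3.@[t] * x 1 = 0.
    rewrite -meval_lin_part lin_partE; move: m10 m20; rewrite /m /= => -> ->.
    by rewrite !meval0; ring.
  rewrite negb_or !negbK; apply/andP; split; apply/eqP/meval_ext => t; rewrite meval0.
    by have := lz (pt2 1 0) t; rewrite !pt2_coord mulr1 mulr0 addr0.
  by have := lz (pt2 0 1) t; rewrite !pt2_coord mulr1 mulr0 add0r.
have [k [l [D [g [hD D0 hg mE gz]]]]] := form_reduction hm mi0.
have gq i j : g i * q j = g j * q i.
  apply: (mulfI D0); rewrite !mulrA -!mE.
  move/eqP: r0; rewrite subr_eq0 => /eqP r0.
  by rewrite /m /q; case: eqP => _; case: eqP => _ //; rewrite r0.
have gi0 : g i0 != 0 by apply: contraNneq mi0 => g0; rewrite mE g0 mulr0.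
have [|h hE] := form_gauss gz gi0 (hg i0) (hq i0).
  by move=> j; exists (q j); rewrite gq mulrC.
have qE j : q j = g j * h.
  by apply: (mulfI gi0); rewrite gq hE; ring.
pose lift (p : {mpoly K[2]}) : {mpoly K[3]} := p \mPo [tuple 'X_0; 'X_1].
pose E := 'X_(2%:R) * lift D + lift h.
have ev (p : {mpoly K[2]}) x : (lift p).@[x] = p.@[pt2 (x 0) (x 1)].
  by rewrite meval_comp2 !mevalXU.
have E1 : mdvd E 1.
  apply: (is_gcd2_mdvd1 hF).
    exists (lift (g 0)); apply: meval_ext => x; rewrite meval_F1.
    rewrite -[m1]/(m 0) -[q1]/(q 0) mE qE !(mevalM, mevalD) mevalXU !ev.
    by ring.
  exists (lift (g 1)); apply: meval_ext => x; rewrite meval_F2.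
  rewrite -[m2]/(m 1) -[q2]/(q 1) mE qE !(mevalM, mevalD) mevalXU !ev.
  by ring.
(* Where [D] is nonzero, [E] can be solved for X_3, so it has a zero, unlike a unit. *)
have [x Dx] := meval_neq0 D0.
have /negP[] := mdvd1_neq0 (pt3 (x 0) (x 1) (- h.@[x] / D.@[x])) E1.
rewrite mevalD mevalM mevalXU !ev !pt3_coord -!(meval_eq _ (pt2E x)).
by rewrite mulfVK // addNr.
Qed.

(** * The forms [a], [b] and the polynomial [P] *)

Variables (d0 : nat) (a b : {mpoly K[2]}).
Hypotheses (hd0 : (1 < d0)%N) (ha : a \is d0.-homog) (hb : b \is d0.-homog).
Hypothesis hab : is_gcd [:: a; b] 1.

Local Notation ab t := (pt2 a.@[t] b.@[t]).
Local Notation w := (a * l2 + b * l3).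
Local Notation F := [tuple F1; F2].
Local Notation P := ((a \mPo F) * X2 - (b \mPo F) * X1).

Lemma ab_nonzero t : nonzero2 t -> nonzero2 (ab t).
Proof. exact: coprime_no_common_zero ha hb hab t. Qed.

(** A linear relation would make a root of one of the two forms a common root. *)
Lemma ab_independent al be : (al != 0) || (be != 0) -> al *: b - be *: a != 0.
Proof.
move=> albe; have d_gt0 := ltnW hd0; apply/negP => /eqP ab0.
have {}ab0 t : al * b.@[t] = be * a.@[t].
  by apply/eqP; rewrite -subr_eq0 -!mevalZ -mevalB ab0 meval0.
have [al0|al0] := eqVneq al 0.
  rewrite al0 eqxx in albe; have [t t0 bt] := form_has_root hb d_gt0.
  have /eqP := ab0 t; rewrite bt mulr0 eq_sym mulf_eq0 (negPf albe) /= => /eqP at0.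
  by have := ab_nonzero t0; rewrite /nonzero2 !pt2_coord at0 bt eqxx.
have [t t0 at0] := form_has_root ha d_gt0.
have /eqP := ab0 t; rewrite at0 mulr0 mulf_eq0 (negPf al0) /= => /eqP bt.
by have := ab_nonzero t0; rewrite /nonzero2 !pt2_coord at0 bt eqxx.
Qed.

Lemma a_neq0 : a != 0.
Proof.
have := @ab_independent 0 1; rewrite oner_eq0 orbT scale0r scale1r sub0r oppr_eq0.
exact.
Qed.

(** If [a * l2 + b * l3 = 0], then [a] divides [l3] by Euclid's lemma. As [a] has degree [d0 > 1],
    this forces [l3 = 0], and then [l2 = 0]. *)
Lemma w_neq0 : w != 0.
Proof.
apply/eqP => w0; have abz : no_common_zero (fun i : 'I_2 => if i == 0 then a else b).
  by move=> t /ab_nonzero/orP[]; rewrite pt2_coord; [exists 0 | exists 1].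
have [|q l3E] := form_gauss abz a_neq0 ha hl3.
  move=> i; case: eqP => _; first by exists l3; rewrite mulrC.
  by exists (- l2); apply/eqP; rewrite -subr_eq0 -w0; apply/eqP; ring.
have l30 : l3 = 0.
  have [q0|q0] := eqVneq q 0; first by rewrite l3E q0 mul0r.
  have [//|l30] := eqVneq l3 0.
  have [|k hk] := mdvd_dhomog (q := q) l30 hl3; first by exists a; rewrite mulrC.
  have /(dhomog_uniq _ hl3) : l3 \is (k + d0).-homog by rewrite l3E; apply: dhomogM.
  by move/(_ l30) => E; have := leq_addl k d0; rewrite -E leqNgt hd0.
move/eqP: w0; rewrite l30 mulr0 addr0 mulf_eq0 (negPf a_neq0) /=.
by apply/negP; move: hl23; rewrite l30 eqxx orbF.
Qed.

Lemma w_homog : w \is (d0 + 1).-homog.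
Proof. by rewrite rpredD // dhomogM. Qed.

Lemma meval_w t : w.@[t] = (lin_part t).@[ab t].
Proof. by rewrite mevalD !mevalM meval_lin_part !pt2_coord; ring. Qed.

(** The map (a : b) of the projective line is onto: a point [x] with R(x) nonzero is reached at a
    root of [x 0 *: b - x 1 *: a]. *)
Lemma resultant3_ab_neq0 : resultant3 \mPo [tuple a; b] != 0.
Proof.
have [x rx] := meval_neq0 resultant3_neq0.
have [|t t0 /eqP] := @form_has_root _ (x 0 *: b - x 1 *: a) d0 _ (ltnW hd0).
  by rewrite rpredB // rpredZ.
rewrite mevalB !mevalZ subr_eq0 => /eqP abt.
have xnz := form_neq0_nonzero2 resultant3_homog rx.
have [c abE] : exists c, ab t =1 (fun i => c * x i).
  by apply: proportional2 => //; rewrite !pt2_coord.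
apply: contraNneq rx => r0; have := congr1 (meval t) r0.
rewrite meval_comp2 (meval_eq _ abE) (dhomog_meval _ _ resultant3_homog) meval0.
move/eqP; rewrite mulf_eq0 => /orP[|/eqP->//]; rewrite expf_eq0 /= => /eqP c0.
have := ab_nonzero t0; rewrite /nonzero2 !abE c0 !mul0r eqxx //.
Qed.

Lemma meval_P x :
  P.@[x] = a.@[pt2 F1.@[x] F2.@[x]] * x 1 - b.@[pt2 F1.@[x] F2.@[x]] * x 0.
Proof. by rewrite mevalB !mevalM !mevalXU !meval_comp2. Qed.

Lemma P_homog : P \is (2 * d0 + 1).-homog.
Proof.
have hT (i : 'I_3) : ('X_i : {mpoly K[3]}) \is 1.-homog by rewrite dhomogX /= mdeg1.
have hFi i : tnth F i \is 2.-homog.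
  by case: i => [[|[|k]] hk].
by rewrite mulnC rpredB // dhomogM // dhomog_comp.
Qed.

(** F(v) is the multiple W R of [t], so [P] at v compares [x] with (a(t), b(t)). *)
Lemma meval_P_conic_pt t x : P.@[conic_pt t x] =
  ((lin_part t).@[x] * resultant3.@[x]) ^+ d0 * (lin_part t).@[x] *
  (x 0 * b.@[t] - x 1 * a.@[t]).
Proof.
rewrite meval_P !conic_ptE (dhomog_meval2 _ _ _ ha) (dhomog_meval2 _ _ _ hb).
by rewrite -!(meval_eq _ (pt2E t)) /conic_pt !pt3_coord; ring.
Qed.

(** Some v(t, x) lies off P = 0: fix [x] with R(x) nonzero, then choose [t] outside the zeros of
    W(t, x) and of [x 0 *: b - x 1 *: a]. *)
Lemma P_neq0 : P != 0.
Proof.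
have [x rx] := meval_neq0 resultant3_neq0.
have xnz := form_neq0_nonzero2 resultant3_homog rx.
(* If W(t, x) were zero for all [t], then m_1 and m_2, hence R, would vanish at [x]. *)
have W0 : x 0 *: l2 + x 1 *: l3 != 0.
  apply: contraNneq rx => W0; have W t : (lin_part t).@[x] = 0.
    rewrite meval_lin_part mulrC [_ * x 1]mulrC -!mevalZ -mevalD W0 meval0 //.
  by rewrite /resultant3 mevalB !mevalM !mevalN !W oppr0 !mul0r subr0.
have [t] := meval_neq0 (mulf_neq0 W0 (ab_independent xnz)).
rewrite mevalM mulf_eq0 negb_or mevalB mevalD !mevalZ => /andP[Wt Bt].
have Px : P.@[conic_pt t x] != 0.
  rewrite meval_P_conic_pt !mulf_neq0 // ?expf_neq0 ?mulf_neq0 //.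
  - by rewrite meval_lin_part mulrC [_ * x 1]mulrC.
  - by rewrite meval_lin_part mulrC [_ * x 1]mulrC.
by apply: contraNneq Px => ->; rewrite meval0.
Qed.

(** * The parameterization [u] *)

Local Notation s := (a * b * l1 + a ^+ 2 * l4 + b ^+ 2 * l5).
Local Notation u := [tuple - a * w; - b * w; s].
Local Notation Fpt x := (pt2 F1.@[x] F2.@[x]).

Lemma meval_u t i : (tnth u i).@[t] = conic_pt t (ab t) i.
Proof.
rewrite [RHS]pt3E [LHS](pt3E (fun i => (tnth u i).@[t])); congr (pt3 _ _ _ i).
- by rewrite mevalM mevalN meval_w.
- by rewrite mevalM mevalN meval_w.
rewrite /conic_pt pt3_coord meval_quad_part !pt2_coord.
by rewrite !mevalD !mevalM; ring.
Qed.

Lemma u_homog i : tnth u i \is (2 * d0 + 1).-homog.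
Proof.
have h2 (f g l : {mpoly K[2]}) : f \is d0.-homog -> g \is d0.-homog ->
    l \is 1.-homog -> f * g * l \is (2 * d0 + 1).-homog.
  by move=> hf hg hl; rewrite mul2n -addnn; apply: dhomogM hl; apply: dhomogM.
have hw (f : {mpoly K[2]}) : f \is d0.-homog -> - f * w \is (2 * d0 + 1).-homog.
  by move=> hf; rewrite mulNr rpredN mulrDr !mulrA; apply: rpredD; apply: h2.
case: i => [[|[|[|i]]] hi] //; rewrite (tnth_nth 0) /=; [exact: hw | exact: hw |].
by rewrite !expr2; apply: rpredD; [apply: rpredD|]; apply: h2.
Qed.

Lemma u_neq0 : tnth u 0 != 0.
Proof. by rewrite (tnth_nth 0) /= mulf_neq0 ?w_neq0 // oppr_eq0 a_neq0. Qed.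


(** * The reduced parameterization [phi] and its inverse *)

Section Curve.
Variables (k l : nat) (D : {mpoly K[2]}) (phi : 3.-tuple {mpoly K[2]}).
Hypotheses (hD : D \is k.-homog) (D0 : D != 0).
Hypothesis hphi : forall i, tnth phi i \is l.-homog.
Hypothesis uE : forall i, tnth u i = D * tnth phi i.
Hypothesis phiz : no_common_zero (tnth phi).

Local Notation phipt t := (fun i => (tnth phi i).@[t]).
(** F(u(t)) = rho(t) t, so psi after phi is the identity off the zeros of [rho]. *)
Local Notation rho := (w * (resultant3 \mPo [tuple a; b])).

Lemma conic_pt_phi t : conic_pt t (ab t) =1 (fun i => D.@[t] * phipt t i).
Proof. by move=> i; rewrite -meval_u uE mevalM. Qed.

Lemma meval_rho t : rho.@[t] = (lin_part t).@[ab t] * resultant3.@[ab t].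
Proof. by rewrite mevalM meval_w meval_comp2. Qed.

Lemma F_phi t : (D.@[t] ^+ 2 * F1.@[phipt t] = rho.@[t] * t 0) *
                (D.@[t] ^+ 2 * F2.@[phipt t] = rho.@[t] * t 1).
Proof.
rewrite -(dhomog_meval _ _ hF1) -(dhomog_meval _ _ hF2) meval_rho.
by rewrite -!(meval_eq _ (conic_pt_phi t)) !conic_ptE.
Qed.

Lemma rho_neq0 : rho != 0.
Proof. by rewrite mulf_neq0 ?w_neq0 ?resultant3_ab_neq0. Qed.

Lemma rho_homog : rho \is (d0 + 1 + 3 * d0).-homog.
Proof.
apply: dhomogM w_homog (dhomog_comp resultant3_homog _).
by case=> [[|[|i]] hi].
Qed.

(** If D(t) = 0, then rho(t) t = F(u(t)) = 0; but [t] is nonzero, since [rho] has positive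
    degree. *)
Lemma rho_D_neq0 t : rho.@[t] != 0 -> nonzero2 t /\ D.@[t] != 0.
Proof.
move=> rt; have t0 : nonzero2 t.
  by move: rho_homog rt; rewrite addn1 => /form_neq0_nonzero2; apply.
split=> //; apply: contraTneq t0 => Dt; rewrite /nonzero2 negb_or !negbK.
have := F_phi t; rewrite Dt expr0n !mul0r => -[/esym/eqP + /esym/eqP].
by rewrite !mulf_eq0 (negPf rt) /= => -> ->.
Qed.

Lemma F_phi_proj t : rho.@[t] != 0 ->
  exists2 c, c != 0 & Fpt (phipt t) =1 (fun i => c * t i).
Proof.
move=> rt; have [t0 Dt] := rho_D_neq0 rt.
have D2 : D.@[t] ^+ 2 != 0 by rewrite expf_neq0.
exists (rho.@[t] / D.@[t] ^+ 2); first by rewrite mulf_neq0 ?invr_eq0.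
move=> i; rewrite (pt2E t i) /pt2; case: ifP => _; apply: (mulfI D2);
  by rewrite F_phi; field.
Qed.

(** Up to a power of [D] this is P(u), and u(t) is v(t, x) for [x] = (a(t), b(t)), where the last
    factor in [meval_P_conic_pt] vanishes. *)
Lemma P_phi : P \mPo phi = 0.
Proof.
have Dn : D ^+ (2 * d0 + 1) != 0 by rewrite expf_neq0.
apply: (mulfI Dn); apply: meval_ext => t; rewrite mulr0 meval0 mevalM rmorphXn /=.
rewrite comp_mpoly_meval -(dhomog_meval _ _ P_homog) -(meval_eq _ (conic_pt_phi t)).
by rewrite meval_P_conic_pt !pt2_coord [a.@[t] * _]mulrC subrr mulr0.
Qed.

(** For t = F(y), the point [y] is on the conic G_t, and by P(y) = 0 on the line through O and (a(t)
    : b(t) : 0). Being different from O, it is the residual intersection u(t). *)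
Lemma phi_F_proj y : (exists i, y i != 0) -> P.@[y] = 0 -> w.@[Fpt y] != 0 ->
  exists2 c, c != 0 & phipt (Fpt y) =1 (fun i => c * y i).
Proof.
set t := Fpt y => -[i0 yi0] Py wt.
have t0 : nonzero2 t by move: w_homog wt; rewrite addn1 => /form_neq0_nonzero2; apply.
have [|mu muE] := @proportional2 _ (ab t) (pt2 (y 0) (y 1)) (ab_nonzero t0).
  by apply/esym/eqP; rewrite !pt2_coord -subr_eq0 -meval_P Py.
have y0E : y 0 = mu * a.@[t] by have := muE 0; rewrite !pt2_coord.
have y1E : y 1 = mu * b.@[t] by have := muE 1; rewrite !pt2_coord.
(* If [mu = 0], then [y] is a multiple of (0, 0, 1), where F_1 and F_2 vanish, so that [t] is
   zero. *)
have mu0 : mu != 0.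
  apply: contraTneq t0 => mu0; rewrite mu0 !mul0r in y0E y1E.
  rewrite /nonzero2 negb_or !negbK /t !pt2_coord.
  have := hG (pt2 0 1) y; have := hG (pt2 1 0) y.
  rewrite !pt2_coord y0E y1E !(mul0r, mulr0, mul1r, addr0, sub0r, subr0, expr0n) /=.
  by move=> -> /eqP; rewrite oppr_eq0 => ->; rewrite eqxx.
have W0 := wt; rewrite meval_w in W0.
set W := (lin_part t).@[ab t] in W0.
have yE i : - (W / mu) * y i = D.@[t] * phipt t i.
  rewrite -conic_pt_phi /conic_pt -/W (pt3E y i) y0E y1E /pt3; case: ifP => _.
    by rewrite !pt2_coord; field.
  case: ifP => _; first by rewrite !pt2_coord; field.
  (* The third coordinate comes from G_t(y) = 0, which reads mu W y_3 + mu^2 S = 0 with S the value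
     of [quad_part] at (a(t), b(t)). *)
  apply: (mulfI mu0); have -> : mu * (- (W / mu) * y 2%:R) = - W * y 2%:R by field.
  apply: (mulfI mu0); have := hG t y; rewrite {1 2}/t !pt2_coord mulrC subrr y0E y1E.
  move/esym/eqP; rewrite -subr_eq0 subr0 => /eqP E.
  apply/eqP; rewrite eq_sym -subr_eq0 -E /W meval_quad_part meval_lin_part !pt2_coord.
  by apply/eqP; ring.
have c0 : - (W / mu) != 0 by rewrite oppr_eq0 mulf_neq0 ?invr_eq0.
have Dt : D.@[t] != 0.
  apply: contraNneq yi0 => Dt; have /eqP := yE i0.
  by rewrite Dt mul0r mulf_eq0 (negPf c0).
exists (- (W / mu) / D.@[t]); first by rewrite mulf_neq0 ?invr_eq0.
by move=> i; apply: (mulfI Dt); rewrite -yE mulrA mulrCA divff ?mulr1.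
Qed.

Lemma w_F_phi_neq0 t : rho.@[t] != 0 -> w.@[Fpt (phipt t)] != 0.
Proof.
move=> rt; have [c c0 cE] := F_phi_proj rt.
rewrite (meval_eq _ cE) (dhomog_meval _ _ w_homog) mulf_neq0 ?expf_neq0 //.
by apply: contraNneq rt; rewrite mevalM => ->; rewrite mul0r.
Qed.

(** * Birationality of [phi] onto the curve *)

Section Birational.
Variable C : plane_curve K.
Hypothesis CP : mdvd (curve_poly C) P.
Hypothesis Cphi : curve_poly C \mPo phi = 0.

Lemma F_same_degree : same_degree F.
Proof. by exists 2%N; case=> [[|[|i]] hi]. Qed.

Lemma phi_gcd : is_gcd phi 1.
Proof.
have [|i0 phi0] := @phiz (pt2 1 0); first by rewrite /nonzero2 !pt2_coord oner_eq0.
apply: (@no_common_zero_gcd _ _ _ _ 0 l (tnth phi) i0) => // [|i|].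
- exact: dhomog1.
- by rewrite mul1r.
by apply: contraNneq phi0 => ->; rewrite meval0.
Qed.

Lemma row_nonzero2 (t : 'rV[K]_2) : t != 0 -> nonzero2 (t 0).
Proof.
apply: contraNT; rewrite negb_or !negbK => /andP[/eqP t0 /eqP t1].
by apply/eqP/rowP => i; rewrite mxE (pt2E (t 0)) t0 t1 /pt2; case: ifP.
Qed.

Lemma row_coord n (x : 'rV[K]_n) : x != 0 -> exists i, x 0 i != 0.
Proof.
move=> x0; apply/existsP; apply: contraNT x0; rewrite negb_exists => /forallP x0.
by apply/eqP/rowP => i; rewrite mxE; apply/eqP/negbNE.
Qed.

Lemma meval_eval_forms m n (f : m.-tuple {mpoly K[n]}) p x :
  p.@[eval_forms f x 0] = p.@[fun i => (tnth f i).@[x 0]].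
Proof. by apply: meval_eq => i; rewrite mxE. Qed.

Lemma meval_eval_F p (x : 'rV[K]_3) : p.@[eval_forms F x 0] = p.@[Fpt (x 0)].
Proof.
rewrite meval_eval_forms.
exact/meval_eq/(pt2E (fun i => (tnth F i).@[x 0])).
Qed.

Lemma phi_param_map : param_map C phi.
Proof.
split; [by exists l | exact: phi_gcd | move=> t t0; apply/andP; split].
  have [i] := phiz (row_nonzero2 t0); apply: contraNneq => p0.
  by have := congr1 (fun x : 'rV[K]_3 => x 0 i) p0; rewrite !mxE => ->.
by rewrite meval_eval_forms -comp_mpoly_meval Cphi meval0.
Qed.

Lemma rho_point : exists2 t : 'rV[K]_2, t \in @proj_space K 2 & rho.@[t 0] != 0.
Proof.
have [t rt] := meval_neq0 rho_neq0; pose r : 'rV[K]_2 := \row_i t i.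
have rE : rho.@[r 0] = rho.@[t] by apply: meval_eq => i; rewrite mxE.
exists r; last by rewrite rE.
have [t0 _] := rho_D_neq0 rt; apply: contraTneq t0 => r0.
rewrite negb_or !negbK.
by have := congr1 (fun x : 'rV[K]_2 => x 0 0) r0;
  have := congr1 (fun x : 'rV[K]_2 => x 0 1) r0; rewrite !mxE => -> ->; rewrite eqxx.
Qed.

Lemma phi_rational_map : rational_map (@proj_space K 2) (curve_points C) phi.
Proof.
split; first by exists l.
(* [phi] vanishes nowhere on the projective line, so the constant form 1 serves. *)
exists 0%N, 1; split; first exact: dhomog1.
  by have [t t0 _] := rho_point; exists t; rewrite ?meval1 ?oner_eq0.
by move=> t t0 _; have [_ _ ->] := phi_param_map.
Qed.

Lemma F_phi_generic : generically (@proj_space K 2)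
  (fun t => proj_eq (eval_forms F (eval_forms phi t)) t).
Proof.
exists (d0 + 1 + 3 * d0)%N, rho; split; [exact: rho_homog | exact: rho_point |].
move=> t _ /F_phi_proj[c c0 cE]; exists c => //; apply/rowP => i.
rewrite !mxE meval_eval_forms -cE.
exact: (pt2E (fun i => (tnth F i).@[phipt (t 0)])).
Qed.

(** The complement of the zeros of [w \mPo F] is the open subset of C on which F is defined and
    inverted by [phi]. *)
Lemma wF_homog : w \mPo F \is ((d0 + 1) * 2).-homog.
Proof.
by apply: dhomog_comp w_homog _; case=> [[|[|i]] hi].
Qed.

Lemma wF_point : exists2 x, x \in curve_points C & (w \mPo F).@[x 0] != 0.
Proof.
have [t t0 rt] := rho_point; have [_ _ phiC] := phi_param_map.
exists (eval_forms phi t); first exact: phiC.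
by rewrite meval_eval_forms meval_comp2 w_F_phi_neq0.
Qed.

Lemma F_rational_map : rational_map (curve_points C) (@proj_space K 2) F.
Proof.
split; first exact: F_same_degree.
exists ((d0 + 1) * 2)%N, (w \mPo F); split; [exact: wF_homog | exact: wF_point |].
move=> x _; rewrite meval_comp2 -meval_eval_F; apply: contraNneq => ->.
(* The zero vector is written as a multiple of itself, so that homogeneity of positive degree makes
   [w] vanish there. *)
rewrite (meval_eq (v2 := fun i => 0 * 0)) => [|i]; last by rewrite mxE mul0r.
by rewrite (dhomog_meval _ _ w_homog) addn1 exprS !mul0r.
Qed.

Lemma phi_F_generic : generically (curve_points C)
  (fun x => proj_eq (eval_forms phi (eval_forms F x)) x).
Proof.
exists ((d0 + 1) * 2)%N, (w \mPo F); split; [exact: wF_homog | exact: wF_point |].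
move=> x /andP[x0 /eqP Cx]; rewrite meval_comp2.
move=> /(phi_F_proj (row_coord x0) (mdvd_meval CP Cx))[c c0 cE].
exists c => //; apply/rowP => i.
by rewrite !mxE meval_eval_F cE.
Qed.

Lemma phi_proper : proper_param C phi.
Proof.
split; first exact: phi_param_map.
exists F; split; [exact: phi_rational_map | exact: F_rational_map
  | exact: F_phi_generic | exact: phi_F_generic].
Qed.

Lemma phi_inverse : param_inverse C F phi.
Proof.
split; first exact: phi_param_map.
split; [exact: F_rational_map | exact: phi_rational_map
  | exact: phi_F_generic | exact: F_phi_generic].
Qed.

End Birational.

(** * The coprime case: the gcd of [u] and the irreducibility of [P] *)

Section Coprime.
Local Notation N := (X1 * (l2 \mPo F) + X2 * (l3 \mPo F)).
Hypothesis NP : is_gcd [:: N; P] 1.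

Lemma meval_N_lin x : N.@[x] = (lin_part (Fpt x)).@[pt2 (x 0) (x 1)].
Proof.
by rewrite mevalD !mevalM !mevalXU !meval_comp2 meval_lin_part !pt2_coord; ring.
Qed.

(** N = W(F, X) = F_1 m_2 - F_2 m_1, in which X_3 cancels. *)
Lemma meval_N x : N.@[x] = resultant3.@[pt2 (x 0) (x 1)].
Proof.
rewrite meval_N_lin lin_partE !pt2_coord meval_F1 meval_F2.
by rewrite /resultant3 mevalB !mevalM; ring.
Qed.

Lemma no_common_line al be : (al != 0) || (be != 0) ->
    (forall x, be * x 0 = al * x 1 -> N.@[x] = 0 /\ P.@[x] = 0) -> False.
Proof.
move=> albe z; pose L : {mpoly K[3]} := linform 0 1 al be.
have LN : mdvd L N by apply: linform_dvd => // x /z[].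
have LP : mdvd L P by apply: linform_dvd => // x /z[].
have := mdvd1_neq0 (pt3 al be 0) (is_gcd2_mdvd1 NP LN LP).
by rewrite meval_linform !pt3_coord mulrC subrr eqxx.
Qed.

(** At a root [t] of [D] the vector u(t) is zero, so W and S vanish at (a(t), b(t)) and G_t contains
    the whole line through O and (a(t) : b(t) : 0). On it N = R vanishes and F is a multiple of [t],
    so [P] vanishes too. *)
Lemma D_unit : D \is a GRing.unit.
Proof.
case: k hD => [|k'] hD'; first exact: dhomog0_unit.
have [t t0 Dt] := form_has_root hD' isT.
have v0 i : conic_pt t (ab t) i = 0 by rewrite conic_pt_phi Dt mul0r.
have abt := ab_nonzero t0; have W0 : (lin_part t).@[ab t] = 0.
  apply/eqP; apply: contraT => W0.
  have /eqP a0 := v0 0; have /eqP b0 := v0 1.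
  rewrite /conic_pt !(pt3_coord, pt2_coord) mulf_eq0 oppr_eq0 (negPf W0) orbF in a0.
  rewrite /conic_pt !(pt3_coord, pt2_coord) mulf_eq0 oppr_eq0 (negPf W0) orbF in b0.
  by move: abt; rewrite /nonzero2 !pt2_coord a0 b0.
have S0 : (quad_part t).@[ab t] = 0 by have := v0 2%:R; rewrite /conic_pt !pt3_coord.
(* W = S = 0 is a linear system with the nonzero solution [t], and its determinant is R up to
   sign. *)
have r0 : resultant3.@[ab t] = 0.
  have := conic_ptE t (ab t).
  move: W0 S0; rewrite lin_partE quad_partE => /eqP + /eqP.
  rewrite !subr_eq0 => /eqP W0 /eqP S0 _.
  have rt0 : t 0 * resultant3.@[ab t] = 0.
    rewrite /resultant3 mevalB !mevalM mulrBr mulrA W0 mulrCA S0; ring.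
  have rt1 : t 1 * resultant3.@[ab t] = 0.
    rewrite /resultant3 mevalB !mevalM mulrBr mulrCA -S0 [t 1 * (_ * _)]mulrA -W0; ring.
  apply/eqP; move/eqP: rt0; move/eqP: rt1; rewrite !mulf_eq0.
  by case/orP: t0 => /negPf->.
exfalso; apply: (no_common_line abt) => x xab.
have [c cE] : exists c, pt2 (x 0) (x 1) =1 (fun i => c * ab t i).
  exact: proportional2.
have x0E : x 0 = c * a.@[t] by have := cE 0; rewrite !pt2_coord.
have x1E : x 1 = c * b.@[t] by have := cE 1; rewrite !pt2_coord.
split.
  by rewrite meval_N (meval_eq _ cE) (dhomog_meval _ _ resultant3_homog) r0 mulr0.
(* G_t(x) = 0 says that F(x) is proportional to [t]. *)
have [|e eE] := @proportional2 _ t (Fpt x) t0.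
  apply/eqP; rewrite !pt2_coord eq_sym -subr_eq0 hG x0E x1E.
  move: W0 S0; rewrite meval_lin_part meval_quad_part !pt2_coord => W0 S0.
  apply/eqP; transitivity (c ^+ 2 * 0 + c * x 2%:R * 0 : K); last by ring.
  by rewrite -{1}S0 -{1}W0; ring.
rewrite meval_P !(meval_eq _ eE) (dhomog_meval _ _ ha) (dhomog_meval _ _ hb) x0E x1E.
by ring.
Qed.

Lemma u_gcd1 : is_gcd u 1.
Proof.
have [_ uD] := no_common_zero_gcd hD hphi uE phiz u_neq0.
split=> [p _|e /uD eD]; first by exists p; rewrite mulr1.
exact: mdvd_trans eD ((mdvd1_unit D).2 D_unit).
Qed.

(** At t = F(X) the form G_t is F_1 F_2 - F_2 F_1 = 0; N is the coefficient of X_3 in its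
    expansion. *)
Lemma N_X3 :
  - (N * X3) = X1 * X2 * (l1 \mPo F) + X1 ^+ 2 * (l4 \mPo F) + X2 ^+ 2 * (l5 \mPo F).
Proof.
apply: meval_ext => x; have := hG (Fpt x) x.
rewrite !pt2_coord mulrC subrr => /esym/eqP; rewrite -subr_eq0 subr0 => /eqP E.
rewrite mevalN mevalM meval_N_lin meval_lin_part !mevalD !mevalM !meval_comp2 !mevalXU.
rewrite !pt2_coord.
by apply/eqP; rewrite eq_sym -subr_eq0 -E; apply/eqP; ring.
Qed.

(* With v = conic_pt, v(F, X) = -N X identically; if (c X_1, c X_2) is congruent
   to (z a(F), z b(F)) modulo P, then c^2 v(F, X) is congruent to z^2 u(F). *)
Lemma P_dvd_vanishing (Q : {mpoly K[3]}) q (c z : {mpoly K[3]}) :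
    Q \is q.-homog -> Q \mPo phi = 0 ->
    mdvd P (c * X1 - z * (a \mPo F)) -> mdvd P (c * X2 - z * (b \mPo F)) ->
  mdvd P ((c ^+ 2 * N) ^+ q * Q).
Proof.
move=> hQ Qphi P1 P2.
pose y := [tuple - (c ^+ 2 * N) * X1; - (c ^+ 2 * N) * X2; - (c ^+ 2 * N) * X3].
pose y' := [tuple z ^+ 2 * (tnth u i \mPo F) | i < 3].
have Qv (v : {mpoly K[3]}) : Q \mPo [tuple v * X1; v * X2; v * X3] = v ^+ q * Q.
  apply: meval_ext => x; rewrite meval_comp3 !mevalM rmorphXn /= !mevalXU.
  by rewrite (dhomog_meval3 _ _ _ _ hQ) -(meval_eq _ (pt3E x)).
have Qy : Q \mPo y = (- (c ^+ 2 * N)) ^+ q * Q by exact: Qv.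
(* Up to the factor z^2 D(F), [y'] is phi(F), where [Q] vanishes. *)
have Qy' : Q \mPo y' = 0.
  apply: meval_ext => x; rewrite meval0 comp_mpoly_meval.
  rewrite (meval_eq (v2 := fun i => (z.@[x] ^+ 2 * D.@[Fpt x]) * phipt (Fpt x) i)).
    by rewrite (dhomog_meval _ _ hQ) -comp_mpoly_meval Qphi meval0 mulr0.
  move=> i; rewrite tnth_mktuple mevalM rmorphXn /= meval_comp2.
  by rewrite uE mevalM mulrA.
have : mdvd P ((Q \mPo y) - (Q \mPo y')).
  apply: comp_mpoly_congr => i; rewrite tnth_mktuple.
  have uF0 : tnth u 0 \mPo F =
      - (a \mPo F) * ((a \mPo F) * (l2 \mPo F) + (b \mPo F) * (l3 \mPo F)).
    by rewrite tnth3 comp_mpolyM comp_mpolyN comp_mpolyD !comp_mpolyM.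
  have uF1 : tnth u 1 \mPo F =
      - (b \mPo F) * ((a \mPo F) * (l2 \mPo F) + (b \mPo F) * (l3 \mPo F)).
    by rewrite tnth3 comp_mpolyM comp_mpolyN comp_mpolyD !comp_mpolyM.
  have uF2 : tnth u 2%:R \mPo F = (a \mPo F) * (b \mPo F) * (l1 \mPo F)
      + (a \mPo F) ^+ 2 * (l4 \mPo F) + (b \mPo F) ^+ 2 * (l5 \mPo F).
    by rewrite tnth3 !expr2 !comp_mpolyD !comp_mpolyM.
  have [h0 h1 h2] := conic_pt_congr P1 P2 (erefl N) N_X3.
  move: i; apply: ord3_ind; rewrite (uF0, uF1, uF2) tnth3;
    [exact: h0 | exact: h1 | exact: h2].
rewrite Qy Qy' subr0 exprNn => -[g gE]; exists ((-1) ^+ q * g).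
rewrite -[RHS]mulrA -gE -[_ * _ ^+ q * Q]mulrA [RHS]mulrA.
by rewrite -expr2 sqrr_sign mul1r.
Qed.

Lemma P_cofactor_unit (Q M : {mpoly K[3]}) q : Q \is q.-homog ->
  Q \mPo phi = 0 -> P = M * Q -> M \is a GRing.unit.
Proof.
move=> hQ Qphi PE; have PN0 := P_neq0; rewrite PE mulf_eq0 negb_or in PN0.
case/andP: PN0 => M0 Q0.
have MP : mdvd M P by exists Q; rewrite PE mulrC.
have [e hM] := mdvd_dhomog P_neq0 P_homog MP.
have Mdvd c z : mdvd P (c * X1 - z * (a \mPo F)) ->
    mdvd P (c * X2 - z * (b \mPo F)) -> mdvd M ((c ^+ 2 * N) ^+ q).
  move=> P1 P2; have [r] := P_dvd_vanishing hQ Qphi P1 P2.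
  by rewrite PE mulrA => /(mulIf Q0) ->; exists r.
(* If M(x) = 0 and N(x) is nonzero, then a(F) and b(F) vanish at [x], so F(x) = 0; but then N(x) =
   W(F(x), x) = 0. *)
have MN x : M.@[x] = 0 -> N.@[x] = 0.
  move=> Mx; apply/eqP; apply: contraT => Nx.
  have c0 c z : mdvd P (c * X1 - z * (a \mPo F)) ->
      mdvd P (c * X2 - z * (b \mPo F)) -> c.@[x] = 0.
    move=> P1 P2; have := mdvd_meval (Mdvd c z P1 P2) Mx.
    rewrite rmorphXn /= mevalM => /eqP; rewrite expf_eq0 mulf_eq0 (negPf Nx) orbF.
    by case/andP=> _; rewrite rmorphXn /= expf_eq0 => /eqP.
  (* For (c, z) = (a(F), X_1) the two differences are 0 and [P]; for (b(F), X_2) they are [- P] and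
     0. *)
  have ax : (a \mPo F).@[x] = 0.
    by apply: (c0 _ X1); [exists 0; ring | exists 1; ring].
  have bx : (b \mPo F).@[x] = 0.
    by apply: (c0 _ X2); [exists (-1); ring | exists 0; ring].
  rewrite !meval_comp2 in ax bx.
  case/negP: Nx; apply: contraT; rewrite meval_N_lin lin_partE.
  have: ~~ nonzero2 (Fpt x).
    by apply/negP => /ab_nonzero; rewrite /nonzero2 !pt2_coord ax bx eqxx.
  by rewrite negb_or !negbK => /andP[/eqP-> /eqP->]; rewrite !mul0r subrr eqxx.
(* [M] does not involve X_3: for fixed (x_1, x_2) with N nonzero it has no root in X_3, as N is free
   of X_3, so it is constant. The factor N disposes of the other points. *)
pose M' := M \mPo [tuple X1; X2; 0].
have MM' : M = M'.
  have N0 : N != 0.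
    have [x] := meval_neq0 resultant3_neq0; apply: contraNneq => N0.
    have := meval_N (pt3 (x 0) (x 1) 0).
    by rewrite N0 meval0 !pt3_coord -(meval_eq _ (pt2E x)) => <-.
  apply: (mulfI N0); apply: meval_ext => x; rewrite (mevalM x N M) (mevalM x N M').
  have [->|Nx] := eqVneq N.@[x] 0; first by rewrite !mul0r.
  congr (_ * _); rewrite meval_comp3 meval0 !mevalXU.
  pose p := mmap polyC (fun i : 'I_3 => if i == 0 then (x 0)%:P
                                        else if i == 1 then (x 1)%:P else 'X) M.
  have pE z : p.[z] = M.@[pt3 (x 0) (x 1) z].
    rewrite horner_mmap; apply: meval_eq => i; rewrite /pt3.
    by do 2?[case: ifP => _]; rewrite !hornerE.
  have: size p == 1%N.
    apply: contraT => /closed_rootP[z /rootP]; rewrite pE => /MN.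
    by rewrite meval_N !pt3_coord -meval_N => Nx0; rewrite Nx0 eqxx in Nx.
  case/size_poly1P => c _ pc.
  by rewrite (meval_eq _ (pt3E x)) -!pE pc !hornerC.
case: e hM => [|e] hM; first exact: dhomog0_unit.
(* As a binary form of positive degree [M] has a root, that is, a line through O on which [M], and
   hence N and [P], vanish. *)
pose M0' : {mpoly K[2]} := M \mPo [tuple T1; T2; 0].
have hM0 : M0' \is e.+1.-homog.
  rewrite -[e.+1]muln1; apply: dhomog_comp hM _.
  case=> [[|[|[|i]]] hi] //; rewrite (tnth_nth 0) /= ?dhomog0 //.
  - by rewrite dhomogX /= mdeg1.
  - by rewrite dhomogX /= mdeg1.
have [t t0 Mt] := form_has_root hM0 isT.
exfalso; apply: (no_common_line t0) => x tx.
have [|c cE] := @proportional2 _ t (pt2 (x 0) (x 1)) t0; first by rewrite !pt2_coord.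
have Mx : M.@[x] = 0.
  have := dhomog_meval c t hM0; rewrite Mt mulr0 -(meval_eq _ cE).
  by rewrite MM' !meval_comp3 !meval0 !mevalXU !pt2_coord.
by split; [exact: MN | exact: mdvd_meval MP Mx].
Qed.

End Coprime.

End Curve.

(** * Construction of the curve *)

Lemma pencil_curve :
  exists (C : plane_curve K) (phi : 3.-tuple {mpoly K[2]}),
    [/\ reduction_of u phi,
        proper_param C phi,
        parameterizable_by C F,
        param_inverse C F phi &
        is_gcd [:: X1 * (l2 \mPo F) + X2 * (l3 \mPo F); P] 1 ->
        [/\ is_gcd u 1,
            curve_degree C = (2 * d0 + 1)%N,
            mirreducible P &
            zero_locus P =i curve_points C]].
Proof.
have [k [l [D [g [hD D0 hg uE gz]]]]] := form_reduction u_homog u_neq0.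
pose phi := [tuple g i | i < 3].
have phiE i : tnth phi i = g i by rewrite tnth_mktuple.
have hphi i : tnth phi i \is l.-homog by rewrite phiE.
have phiz : no_common_zero (tnth phi).
  by move=> t /gz[i gi]; exists i; rewrite phiE.
have {}uE i : tnth u i = D * tnth phi i by rewrite phiE; apply: uE.
have uD : is_gcd u D by apply: no_common_zero_gcd hD hphi uE phiz u_neq0.
(* Composition with [phi] kills [P], hence an irreducible factor [Q] of it, which defines C. *)
have [Q [Qirr QP Qphi]] := irreducible_factor
  (ev := comp_mpoly phi : {rmorphism {mpoly K[3]} -> {mpoly K[2]}}) P_neq0 (P_phi D0 uE).
have [q hQ] := mdvd_dhomog P_neq0 P_homog QP.
pose C := PlaneCurve hQ Qirr.
have inv : param_inverse C F phi by apply: (phi_inverse hphi uE phiz).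
exists C, phi; split=> // [|||NP].
- by exists D.
- by apply: (phi_proper hphi uE phiz).
- by exists phi.
have [M PE] := QP.
(* [P] and [Q] now differ by a unit, and share degree, irreducibility and zeros. *)
have uM : M \is a GRing.unit by apply: (P_cofactor_unit uE NP hQ Qphi PE).
have [Q0 QNu Qfact] := Qirr.
have MP : mdvd M P by exists Q; rewrite PE mulrC.
have PN0 := P_neq0; have M0 : M != 0 by apply: contraNneq PN0 => M0; rewrite PE M0 mul0r.
split; first by apply: (u_gcd1 hD D0 hphi uE phiz NP).
- have /andP[/eqP Mc _] : M \in @mpoly_unit 3 K := uM.
  have : P \is q.-homog by rewrite PE Mc mul_mpolyC; apply: rpredZ.
  by move/(dhomog_uniq PN0 P_homog).
- split=> //; first by rewrite PE unitrMr.
  move=> f h; rewrite PE => fh.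
  have QE : Q = (M^-1 * f) * h by rewrite -mulrA -fh mulKr.
  by case: (Qfact _ _ QE); [rewrite unitrM => /andP[_]; left | right].
move=> x; rewrite !inE; congr (_ && _).
by rewrite PE mevalM mulf_eq0 (negPf (mdvd1_neq0 _ ((mdvd1_unit M).2 uM))).
Qed.

End Pencil.

(** * From the generic conic to the evaluated pencil *)

Lemma mmap_map_mpolyC (K : fieldType) m n (p : {mpoly K[n]})
    (t : 'I_m -> K) (x : 'I_n -> K) :
  mmap (meval t) x (map_mpoly (@mpolyC m K) p) = p.@[x].
Proof.
pose f := @mpolyC m K : {rmorphism K -> {mpoly K[m]}}.
have fD p' q : map_mpoly f (p' + q) = map_mpoly f p' + map_mpoly f q by exact: mmapD.
have hD (p' q : {mpoly {mpoly K[m]}[n]}) :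
  mmap (meval t) x (p' + q) = mmap (meval t) x p' + mmap (meval t) x q by exact: mmapD.
have fE c mm : map_mpoly f (c *: 'X_[mm]) = c%:MP *: 'X_[mm].
  by rewrite (map_mpolyZ f) (map_mpolyX f).
have hE c mm : mmap (meval t) x (c%:MP *: 'X_[mm]) = c * \prod_i x i ^+ mm i.
  by rewrite mmapZ mmapX /= mevalC.
rewrite -[@mpolyC m K]/(f : K -> _).
elim/mpolyind: p => [|c mm p _ _ IH].
  by rewrite [map_mpoly _ _]mmap0 mmap0 meval0.
by rewrite fD hD fE hE IH mevalD mevalZ mevalX.
Qed.

(** The evaluation of T at [t] and X at [x] is a ring morphism [h], applied to both sides. *)
Lemma pencil_meval (K : closedFieldType) (F1 F2 : {mpoly K[3]})
    (l1 l2 l3 l4 l5 : {mpoly K[2]}) t x :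
    pencil F1 F2 = l1 *: (X1 * X2) + l2 *: (X1 * X3) + l3 *: (X2 * X3)
                   + l4 *: X1 ^+ 2 + l5 *: X2 ^+ 2 ->
  t 0 * F2.@[x] - t 1 * F1.@[x] =
  l1.@[t] * (x 0 * x 1) + l2.@[t] * (x 0 * x 2%:R) + l3.@[t] * (x 1 * x 2%:R)
  + l4.@[t] * x 0 ^+ 2 + l5.@[t] * x 1 ^+ 2.
Proof.
pose h := mmap (meval t) x : {mpoly {mpoly K[2]}[3]} -> K.
have hD (p q : {mpoly {mpoly K[2]}[3]}) : h (p + q) = h p + h q by exact: mmapD.
have hB (p q : {mpoly {mpoly K[2]}[3]}) : h (p - q) = h p - h q by exact: mmapB.
have hZ (c : {mpoly K[2]}) (p : {mpoly {mpoly K[2]}[3]}) : h (c *: p) = c.@[t] * h p.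
  exact: mmapZ.
have hM (p q : {mpoly {mpoly K[2]}[3]}) : h (p * q) = h p * h q by exact: rmorphM.
have hX i : h 'X_i = x i by rewrite /h mmapX mmap1U.
have hC p : h (map_mpoly (@mpolyC 2 K) p) = p.@[x] by exact: mmap_map_mpolyC.
clearbody h; move/(congr1 h).
have -> : h (pencil F1 F2) = t 0 * F2.@[x] - t 1 * F1.@[x].
  by rewrite /pencil hB; congr (_ - _); rewrite hZ hC mevalXU.
have hXX i j : h ('X_i * 'X_j) = x i * x j by rewrite hM; congr (_ * _); apply: hX.
move=> ->; do 4![rewrite hD; congr (_ + _); last by rewrite hZ ?expr2 hXX].
by rewrite hZ hXX.
Qed.

(** A form in X_1 and X_2 alone splits: X_2 divides it if [c4 = 0], and otherwise a root [r] of the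
    dehomogenised quadratic gives the factors. *)
Lemma binary_quadratic_degenerate (L : closedFieldType) (c1 c4 c5 : L) :
  degenerate_conic (c1 *: (X1 * X2) + c4 *: X1 ^+ 2 + c5 *: X2 ^+ 2).
Proof.
have h1 (i : 'I_3) : ('X_i : {mpoly L[3]}) \is 1.-homog by rewrite dhomogX /= mdeg1.
have [->|c40] := eqVneq c4 0.
  exists X2, (c1 *: X1 + c5 *: X2); split=> //; first by rewrite rpredD ?rpredZ.
  by rewrite -!mul_mpolyC; ring.
pose p := c4 *: 'X ^+ 2 + c1 *: 'X + c5%:P : {poly L}.
have p2 : p`_2 = c4.
  by rewrite !coefE /= mulr1 mulr0 !addr0.
have /closed_rootP[r /rootP] : size p != 1%N.
  by apply: contraNneq c40 => sp; rewrite -p2 nth_default ?sp.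
rewrite !hornerE => pr.
have h2 c : (X1 + c *: X2 : {mpoly L[3]}) \is 1.-homog.
  by apply: rpredD => //; apply: rpredZ.
have [e c1E] : exists e, c1 = c4 * e by exists (c1 / c4); field.
(* By Vieta the second root is [- (e + r)], with [e] the quotient of [c1] by [c4]. *)
exists (c4 *: (X1 + (- r) *: X2)), (X1 + (e + r) *: X2).
split; [exact: rpredZ | exact: h2 |].
move/eqP: pr; rewrite addrC addr_eq0 => /eqP ->; rewrite c1E.
by rewrite -!mul_mpolyC !(mpolyCM, mpolyCD, mpolyCN, rmorphXn) /=; ring.
Qed.

Theorem proposition2p4
  (K : closedFieldType)
  (L : closedFieldType) (iota : {rmorphism {fraction {mpoly K[2]}} -> L})
  (hL : is_algebraic_closure iota)
  (F1 F2 : {mpoly K[3]})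
  (hF1 : F1 \is 2.-homog) (hF2 : F2 \is 2.-homog)
  (hF : is_gcd [:: F1; F2] 1)
  (hF1p : F1.@[tnth [tuple 0; 0; 1]] = 0)
  (hF2p : F2.@[tnth [tuple 0; 0; 1]] = 0)
  (l1 l2 l3 l4 l5 : {mpoly K[2]})
  (hl1 : l1 \is 1.-homog) (hl2 : l2 \is 1.-homog) (hl3 : l3 \is 1.-homog)
  (hl4 : l4 \is 1.-homog) (hl5 : l5 \is 1.-homog)
  (hl : pencil F1 F2 = l1 *: (X1 * X2) + l2 *: (X1 * X3) + l3 *: (X2 * X3)
                       + l4 *: X1 ^+ 2 + l5 *: X2 ^+ 2)
  (hnd : ~ degenerate_conic (to_closure iota (pencil F1 F2)))
  (d0 : nat) (hd0 : (1 < d0)%N)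
  (a b : {mpoly K[2]})
  (ha : a \is d0.-homog) (hb : b \is d0.-homog)
  (hab : is_gcd [:: a; b] 1) :
  let F := [tuple F1; F2] in
  let u1 := - a * (a * l2 + b * l3) in
  let u2 := - b * (a * l2 + b * l3) in
  let u3 := a * b * l1 + a ^+ 2 * l4 + b ^+ 2 * l5 in
  let u := [tuple u1; u2; u3] in
  let P := (a \mPo F) * X2 - (b \mPo F) * X1 in
  exists (C : plane_curve K) (phi : 3.-tuple {mpoly K[2]}),
    [/\ reduction_of u phi,
        proper_param C phi,
        parameterizable_by C F,
        param_inverse C F phi &
        is_gcd [:: X1 * (l2 \mPo F) + X2 * (l3 \mPo F); P] 1 ->
        [/\ is_gcd u 1,
            curve_degree C = (2 * d0 + 1)%N,
            mirreducible P &
            zero_locus P =i curve_points C]].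
Proof.
have hG t x := pencil_meval t x hl.
(* If [l2] and [l3] were both zero, the generic conic would be a form in X_1 and X_2 only, hence a
   product of two linear forms. *)
have hl23 : (l2 != 0) || (l3 != 0).
  apply: contraT; rewrite negb_or !negbK => /andP[/eqP l20 /eqP l30].
  case: hnd; rewrite hl l20 l30 !scale0r !addr0 /to_closure.
  pose g := iota \o @tofrac {mpoly K[2]} : {rmorphism {mpoly K[2]} -> L}.
  have gD p q : map_mpoly g (p + q) = map_mpoly g p + map_mpoly g q :> {mpoly L[3]}.
    exact: mmapD.
  have gZ c p : map_mpoly g (c *: p) = g c *: map_mpoly g p :> {mpoly L[3]}.
    exact: map_mpolyZ.
  have gM p q : map_mpoly g (p * q) = map_mpoly g p * map_mpoly g q :> {mpoly L[3]}.
    exact: rmorphM.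
  have gX i : map_mpoly g 'X_i = 'X_i :> {mpoly L[3]} by exact: map_mpolyX.
  have gXX i j : map_mpoly g ('X_i * 'X_j) = 'X_i * 'X_j :> {mpoly L[3]}.
    by rewrite gM; congr (_ * _); apply: gX.
  rewrite -[_ \o _]/(g : _ -> _).
  suff -> : map_mpoly g (l1 *: (X1 * X2) + l4 *: X1 ^+ 2 + l5 *: X2 ^+ 2) =
      g l1 *: (X1 * X2) + g l4 *: X1 ^+ 2 + g l5 *: X2 ^+ 2 :> {mpoly L[3]}.
    exact: binary_quadratic_degenerate.
  by do 2![rewrite gD; congr (_ + _); last by rewrite gZ !expr2 gXX]; rewrite gZ gXX.
exact: (pencil_curve hF1 hF2 hF hl1 hl2 hl3 hl4 hl5 hG hl23 hd0 ha hb hab).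
Qed.
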